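(* Let $K$ be a finite extension of $\mathbb Q_p$ with ring of integers $\mathcal O_K$, let $f\in\mathcal O_K(x)$ be a rational map of degree $d$ with $2\le d<p$ and good reduction, and let $\alpha_0\in K$. If the arboreal representation of $f$ with base point $\alpha_0$ is infinitely ramified, then one of its branch representations is infinitely ramified.
   Context: The arboreal representation with base point $\alpha_0$ is the action of $\Gamma_K=\operatorname{Gal}(\bar K/K)$ on the tree of all iterated preimages $\bigcup_n f^{-n}(\alpha_0)$. A branch is a sequence $(\alpha_n)_{n\in\mathbb N}$ with $f(\alpha_{n+1})=\alpha_n$ starting at $\alpha_0$; its branch representation is the action of $\Gamma_K$ on the tree formed by the Galois orbit of the branch. A representation of $\Gamma_K$ is infinitely ramified if there is no finite extension $L/K$ such that its restriction to $\operatorname{Gal}(\bar K/L)$ is unramified (trivial on inertia). *)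

(* Defs.v *)
From mathcomp Require Import all_boot all_order all_algebra.
Set Implicit Arguments. Unset Strict Implicit. Unset Printing Implicit Defensive.
Import Order.TTheory GRing.Theory Num.Theory.
Local Open Scope ring_scope.

Section Defs.
Variables (R : realFieldType) (Kbar : fieldType) (av : Kbar -> R).

Definition nonarch_abs : Prop :=
  [/\ forall x, 0 <= av x,
      forall x, av x = 0 <-> x = 0,
      forall x y, av (x * y) = av x * av y
    & forall x y, av (x + y) <= Num.max (av x) (av y)].

Definition padic_on_nat (p : nat) : Prop :=
  forall n : nat, (0 < n)%N -> av (n%:R) = (p%:R : R) ^- (logn p n).

Definition is_subfield (S : Kbar -> Prop) : Prop :=
  [/\ S 0, S 1,
      forall x y, S x -> S y -> S (x - y),
      forall x y, S x -> S y -> S (x * y)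
    & forall x, S x -> S x^-1].

Definition cauchy (u : nat -> Kbar) : Prop :=
  forall e : R, 0 < e -> exists N, forall m n, (N <= m)%N -> (N <= n)%N ->
    av (u m - u n) < e.

Definition converges (u : nat -> Kbar) (l : Kbar) : Prop :=
  forall e : R, 0 < e -> exists N, forall n, (N <= n)%N -> av (u n - l) < e.

Definition complete_in (S : Kbar -> Prop) : Prop :=
  forall u : nat -> Kbar, (forall n, S (u n)) -> cauchy u ->
    exists l, S l /\ converges u l.

(* The closure of Q inside Kbar (this is Q_p when it is complete and av is
   p-adic on Q). *)
Definition Qp_in : Kbar -> Prop :=
  fun x => forall e : R, 0 < e -> exists q : rat, av (x - ratr q) < e.

Definition finite_over (S L : Kbar -> Prop) : Prop :=
  exists b : seq Kbar, forall x, L x ->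
    exists c : nat -> Kbar, (forall i, S (c i)) /\
      x = \sum_(i < size b) c i * b`_i.

Definition algebraic_over (S : Kbar -> Prop) (x : Kbar) : Prop :=
  exists P : {poly Kbar}, P != 0 /\ (forall i, S P`_i) /\ root P x.

Definition finite_ext (K L : Kbar -> Prop) : Prop :=
  [/\ is_subfield L, forall x, K x -> L x & finite_over K L].

Definition field_aut (s : Kbar -> Kbar) : Prop :=
  [/\ forall x y, s (x + y) = s x + s y,
      forall x y, s (x * y) = s x * s y,
      s 1 = 1 & bijective s].

Definition in_Gal (L : Kbar -> Prop) (s : Kbar -> Kbar) : Prop :=
  field_aut s /\ forall x, L x -> s x = x.

(* sigma in the inertia subgroup of Gal(Kbar / L): acts trivially on the
   residue field of Kbar *)
Definition in_inertia (L : Kbar -> Prop) (s : Kbar -> Kbar) : Prop :=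
  in_Gal L s /\ forall x, av x <= 1 -> av (s x - x) < 1.

(* Galois action on P^1(Kbar) = option Kbar (None = infinity) *)
Definition act (s : Kbar -> Kbar) (z : option Kbar) : option Kbar := omap s z.

(* A set T of points of P^1(Kbar) (stable under Gal(Kbar/K)) gives a
   representation of Gal(Kbar/K); it is infinitely ramified if there is no
   finite extension L/K such that the inertia of Gal(Kbar/L) acts trivially
   on T. *)
Definition infinitely_ramified (K : Kbar -> Prop) (T : option Kbar -> Prop)
  : Prop :=
  ~ exists L, finite_ext K L /\
      forall s, in_inertia L s -> forall z, T z -> act s z = z.

End Defs.

Section RatMap.
Variable (Kbar : fieldType).

Definition ratmap (d : nat) (F G : {poly Kbar}) (z : option Kbar)
  : option Kbar :=
  match z with
  | Some x => if G.[x] != 0 then Some (F.[x] / G.[x]) else None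
  | None => if G`_d != 0 then Some (F`_d / G`_d) else None
  end.

(* homogeneous resultant of F and G viewed as binary forms of degree d
   (Sylvester determinant of the padded coefficient vectors) *)
Definition hres (d : nat) (F G : {poly Kbar}) : Kbar :=
  \det (\matrix_(i < d + d, j < d + d)
          (let H := if (i < d)%N then F else G in
           let i' := if (i < d)%N then (i : nat) else (i - d)%N in
           if (i' <= j)%N && (j <= i' + d)%N then H`_(d - (j - i')) else 0)).

Definition preimage_tree (f : option Kbar -> option Kbar) (a0 : option Kbar)
  : option Kbar -> Prop :=
  fun z => exists n, iter n f z = a0.

Definition is_branch (f : option Kbar -> option Kbar) (a0 : option Kbar)
  (b : nat -> option Kbar) : Prop :=
  b 0%N = a0 /\ forall n, f (b n.+1) = b n.

Definition branch_tree (K : Kbar -> Prop) (b : nat -> option Kbar)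
  : option Kbar -> Prop :=
  fun z => exists s n, in_Gal K s /\ z = act s (b n).

End RatMap.

(* Main.v *)
(* Call a residue class of P^1 critical if f is not injective on it; as d < p,
   the Wronskian of f does not vanish identically modulo the maximal ideal, so
   there are finitely many critical classes, and f strictly decreases distances
   inside each of them.

   If a critical class contains u and v <> u with f^m(v) = u and u above a0,
   then lifting u, v backwards around the cycle inside residue classes gives a
   branch along which the distance of consecutive returns strictly increases
   and stays below 1.  The value group of a finite extension L of K has bounded
   exponent over p^Z, so these distances are not all values of L, and the
   inertia group of L moves the branch.

   Otherwise a path of the tree can branch inside its residue classes at most
   once per critical class, so the inertia orbits on the tree are bounded.
   Hence the increments s(x) - x have values in |L| for L = K(p^(1/N)), N
   suitable, and tameness (orbits of s over a fixed point have length at most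
   d < p) forces the inertia of L to act trivially.

   Both halves rest on the fact that an element fixed by the inertia of L has
   the value of an element of L.  For this one takes a maximal extension M of L
   with the same value group: M is closed, its residue field is that of Kbar,
   and Kbar/M is Galois with isometric automorphisms, so that Gal(Kbar/M) lies
   in the inertia group.  Completeness of Q_p is replaced by the closedness
   of M. *)

From HB Require Import structures.
Require Import Defs.
From mathcomp Require Import all_boot all_order all_algebra.
From mathcomp Require Import boolp classical_sets.
From mathcomp Require Import zify ring.
Set Implicit Arguments. Unset Strict Implicit. Unset Printing Implicit Defensive.
Import Order.TTheory GRing.Theory Num.Theory.
Local Open Scope ring_scope.

(** * Subfields given by predicates *)

Section Subfield.
Variables (F : fieldType) (S : F -> Prop) (hS : is_subfield S).

(* The proof [hS] is kept in the term so that the closure properties can be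
   inferred from [sfpred hS]. *)
Definition sfpred of is_subfield S : {pred F} := fun x => `[< S x >].

Lemma sfpredP x : reflect (S x) (x \in sfpred hS).
Proof. exact: asboolP. Qed.

Lemma sfpred_divring : divring_closed (sfpred hS).
Proof.
case: (hS) => S0 S1 SB SM SV; split; first exact/sfpredP.
- by move=> x y /sfpredP Sx /sfpredP Sy; apply/sfpredP/SB.
- by move=> x y /sfpredP Sx /sfpredP Sy; apply/sfpredP/SM => //; apply: SV.
Qed.

HB.instance Definition _ := GRing.isDivringClosed.Build F (sfpred hS) sfpred_divring.

Lemma subfieldD x y : S x -> S y -> S (x + y).
Proof. by move=> /sfpredP Sx /sfpredP Sy; apply/sfpredP/rpredD. Qed.
Lemma subfieldN x : S x -> S (- x).
Proof. by move=> /sfpredP Sx; apply/sfpredP; rewrite rpredN. Qed.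
Lemma subfieldX x n : S x -> S (x ^+ n).
Proof. by move=> /sfpredP Sx; apply/sfpredP/rpredX. Qed.
Lemma subfield_nat n : S n%:R.
Proof. exact/sfpredP/rpred_nat. Qed.

(** The subfield as a field in its own right, so that irreducibility, division and Bezout relations
    over it are available. *)
Definition sftype := {x : F | x \in sfpred hS}.
HB.instance Definition _ := [isSub for (@sval F (fun x => x \in sfpred hS)) : sftype -> F].
HB.instance Definition _ := [Choice of sftype by <:].
HB.instance Definition _ := [SubChoice_isSubIntegralDomain of sftype by <:].
HB.instance Definition _ := [SubIntegralDomain_isSubField of sftype by <:].

Definition sfval : sftype -> F := val.
HB.instance Definition _ := GRing.RMorphism.on sfval.
Lemma sfvalP (x : sftype) : S (sfval x).
Proof. exact/sfpredP/(valP x). Qed.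
Lemma sfval_ex x : S x -> exists y : sftype, sfval y = x.
Proof. by move=> /sfpredP h; exists (Sub x h). Qed.
Lemma poly_over_sf (P : {poly F}) : (forall i, S P`_i) -> exists Q : {poly sftype}, P = map_poly sfval Q.
Proof.
move=> h; exists (\poly_(i < size P) (Sub P`_i (introT (sfpredP _) (h i)) : sftype)).
apply/polyP=> i; rewrite coef_map coef_poly; case: ltnP => hi; first by [].
by rewrite nth_default ?raddf0.
Qed.
End Subfield.
(** A nonzero polynomial of least size vanishing at [x] is irreducible: one of two factors vanishes
    at [x], and by minimality it has the full size. *)
Lemma irreducible_root (F E : fieldType) (i : {rmorphism F -> E}) (x : E) (A : {poly F}) :
  A != 0 -> root (map_poly i A) x ->
  exists P : {poly F}, irreducible_poly P /\ root (map_poly i P) x.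
Proof.
have [n] := ubnP (size A); elim: n A => // n IHn A /ltnSE leAn A0 rA.
have [[B [B0 rB ltBA]]|minA] :=
    pselect (exists B : {poly F}, [/\ B != 0, root (map_poly i B) x & (size B < size A)%N]).
  by apply: (IHn B) => //; apply: leq_trans ltBA leAn.
have leA B : B != 0 -> root (map_poly i B) x -> (size A <= size B)%N.
  by move=> B0 rB; rewrite leqNgt; apply/negP => ltBA; apply: minA; exists B.
exists A; split=> //; split.
  rewrite ltnNge; apply/negP => /size1_polyC AE; move: rA A0.
  by rewrite AE map_polyC /= rootC fmorph_eq0 => /eqP ->; rewrite polyC0 eqxx.
move=> q q1 qA; case/dvdpP: (qA) => r Ar.
have [r0 q0] : r != 0 /\ q != 0 by apply/andP; rewrite -negb_or -mulf_eq0 -Ar.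
move: rA; rewrite Ar rmorphM rootM => /orP[] h; last first.
  by rewrite -dvdp_size_eqp ?dvdp_mull // eqn_leq dvdp_leq ?mulf_neq0 ?dvdp_mull //= -Ar leA.
exfalso; have := leA _ r0 h; rewrite Ar size_mul //.
move: q1; rewrite -size_poly_gt0 in q0.
case: (size q) q0 => [|[|k]] // _ _.
by rewrite !addnS /= -addSn leqNgt leq_addr.
Qed.

(** * Roots of one irreducible polynomial under two embeddings *)

Section TwoEmbeddings.
Variables (F E : fieldType) (i1 i2 : {rmorphism F -> E}) (x1 x2 : E) (P : {poly F}).
Hypotheses (irrP : irreducible_poly P) (rP1 : root (map_poly i1 P) x1)
  (rP2 : root (map_poly i2 P) x2).

(** [P] and [A] are coprime over [F], and the Bezout coefficient of [A] inverts its value at the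
    root under either embedding. One [B] for both is what makes the graph in [piso_adjoin] closed
    under inverses. *)
Lemma irreducible_inverse (A : {poly F}) : (map_poly i1 A).[x1] != 0 ->
  exists B, (map_poly i1 A).[x1] * (map_poly i1 B).[x1] = 1 /\
            (map_poly i2 A).[x2] * (map_poly i2 B).[x2] = 1.
Proof.
move=> nz; have : coprimep P A.
  rewrite irreducible_poly_coprime //; apply: contra nz => /dvdpP[q ->].
  by rewrite rmorphM hornerM (rootP rP1) mulr0.
case/Bezout_eq1_coprimepP=> [[u v] /= uv]; exists v.
have e (i : {rmorphism F -> E}) y : root (map_poly i P) y ->
    (map_poly i A).[y] * (map_poly i v).[y] = 1.
  move=> /rootP ry; have := congr1 (fun Q => (map_poly i Q).[y]) uv.
  by rewrite rmorphD !rmorphM hornerD !hornerM ry mulr0 add0r rmorph1 hornerC mulrC.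
by split; apply: e.
Qed.

(** Vanishing at a root of [P] means divisibility by [P], a condition over [F] alone. So sending
    [x1] to [x2] is well defined. *)
Lemma irreducible_root_transfer (A : {poly F}) :
  (map_poly i1 A).[x1] = 0 -> (map_poly i2 A).[x2] = 0.
Proof.
move=> /eqP rA; apply/eqP; have : P %| A.
  apply: contraLR rA => ndvd; move: (irreducible_poly_coprime A irrP).
  rewrite ndvd => /Bezout_eq1_coprimepP[[u v] /= uv].
  apply/eqP => A0; have := congr1 (fun Q => (map_poly i1 Q).[x1]) uv.
  rewrite rmorphD !rmorphM hornerD !hornerM (rootP rP1) A0 !mulr0 add0r rmorph1 hornerC.
  by move/esym/eqP; rewrite oner_eq0.
by case/dvdpP=> q ->; rewrite rmorphM hornerM (rootP rP2) mulr0.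
Qed.
End TwoEmbeddings.

Lemma algebraic_sf (F : fieldType) (S : F -> Prop) (hS : is_subfield S) x :
  algebraic_over S x ->
  exists P : {poly sftype hS}, irreducible_poly P /\ root (map_poly (sfval (hS := hS)) P) x.
Proof.
case=> A [A0 [/(poly_over_sf hS)[Q AQ]]] rA.
by apply: (@irreducible_root _ _ _ _ Q); rewrite -?AQ //; apply: contraNneq A0 => Q0; rewrite AQ Q0 rmorph0.
Qed.

(** * Simple algebraic extensions and finite extensions *)

Definition adjoin (F : fieldType) (S : F -> Prop) (x y : F) : Prop :=
  exists A : {poly F}, (forall i, S A`_i) /\ y = A.[x].

Section Adjoin.
Variables (F : fieldType) (S : F -> Prop) (hS : is_subfield S) (x : F).

Lemma adjoinP y : adjoin S x y <->
  exists A : {poly sftype hS}, y = (map_poly (sfval (hS := hS)) A).[x].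
Proof.
split=> [[A [/(poly_over_sf hS)[Q ->] ->]]|[A ->]]; first by exists Q.
exists (map_poly (sfval (hS := hS)) A); split=> // i.
by rewrite coef_map; apply: sfvalP.
Qed.

Lemma adjoin_base y : S y -> adjoin S x y.
Proof.
move=> Sy; exists y%:P; split; last by rewrite hornerC.
by case: hS => S0 _ _ _ _ i; rewrite coefC; case: eqP.
Qed.

Lemma adjoin_gen : adjoin S x x.
Proof.
exists 'X; split; last by rewrite hornerX.
by case: hS => S0 S1 _ _ _ i; rewrite coefX; case: eqP.
Qed.

Lemma adjoin_subfield : algebraic_over S x -> is_subfield (adjoin S x).
Proof.
move=> /(algebraic_sf hS)[P [irrP rP]]; split.
- by apply: adjoin_base; case: hS.
- by apply: adjoin_base; case: hS.
- move=> _ _ /adjoinP[A ->] /adjoinP[B ->]; apply/adjoinP; exists (A - B).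
  by rewrite rmorphB hornerD hornerN.
- move=> _ _ /adjoinP[A ->] /adjoinP[B ->]; apply/adjoinP; exists (A * B).
  by rewrite rmorphM hornerM.
move=> _ /adjoinP[A ->]; have [->|nz] := eqVneq (map_poly (sfval (hS := hS)) A).[x] 0.
  by rewrite invr0; apply: adjoin_base; case: hS.
have [B [AB _]] := irreducible_inverse irrP rP rP nz.
by apply/adjoinP; exists B; apply: (mulfI nz); rewrite AB mulfV.
Qed.
End Adjoin.

Lemma finite_over_root (F : fieldType) (S L : F -> Prop) (hS : is_subfield S) (b : seq F) :
  (forall x, L x -> exists c : nat -> F, (forall i, S (c i)) /\
      x = \sum_(i < size b) c i * b`_i) ->
  forall x, (forall k, L (x ^+ k)) ->
  exists P : {poly F}, [/\ P != 0, forall i, S P`_i, (size P <= (size b).+1)%N & root P x].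
Proof.
move=> hb x Lx; set n := size b.
have hc k : exists c : 'I_n -> sftype hS, x ^+ k = \sum_(i < n) sfval (c i) * b`_i.
  have [c [Sc xE]] := hb _ (Lx k).
  exists (fun i => Sub (c i) (introT (sfpredP _ _) (Sc i))); exact: xE.
(* The coordinates of [n.+1] powers of [x] form a matrix with only [n] columns; a nonzero row of its
   left kernel is a linear relation between the powers. *)
pose C := \matrix_(k < n.+1, i < n) (projT1 (cid (hc k))) i.
have : kermx C != 0.
  rewrite kermx_eq0 /row_free neq_ltn; apply/orP; left.
  by rewrite ltnS rank_leq_col.
case/matrix0Pn => j [k0 nz].
pose v (k : nat) := kermx C j (inord k).
have vC i : \sum_(k < n.+1) v k * C k i = 0.
  have := mulmx_ker C => /matrixP/(_ j i); rewrite !mxE => E; rewrite -[RHS]E.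
  by apply: eq_bigr => k _; rewrite /v inord_val.
exists (\poly_(k < n.+1) sfval (v k)); split; last 1 first.
- apply/rootP; rewrite horner_poly.
  under eq_bigr => k _ do rewrite (projT2 (cid (hc k))) mulr_sumr.
  rewrite exchange_big big1 //= => i _.
  have := congr1 (@sfval _ _ hS) (vC i); rewrite rmorph0 raddf_sum => E.
  under eq_bigr => k _ do rewrite mulrA.
  rewrite -mulr_suml [X in X * _](_ : _ = 0) ?mul0r // -[RHS]E.
  by apply: eq_bigr => k _; rewrite -[RHS]/(sfval (v k * C k i)) rmorphM mxE.
- apply: contraNneq nz => /(congr1 (fun Q : {poly F} => Q`_k0)); rewrite coef_poly coef0 ltn_ord /v inord_val.
  by move/eqP; rewrite fmorph_eq0.
- by move=> i; rewrite coef_poly; case: ifP => _; [apply: sfvalP | case: (hS)].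
- exact: size_poly.
Qed.
(** * Automorphisms over a subfield *)

Section ExtendAut.
Variables (E : fieldType) (M : E -> Prop) (hM : is_subfield M).

(* The graph of an isomorphism over M between two subfields of E. *)
Definition partial_iso (G : set (E * E)) : Prop :=
  [/\ forall x, M x -> G (x, x),
      forall u v, G u -> G v -> G (u.1 - v.1, u.2 - v.2),
      forall u v, G u -> G v -> G (u.1 * v.1, u.2 * v.2),
      forall u, G u -> G (u.1^-1, u.2^-1)
    & forall y, G (0, y) -> y = 0].

Section Basics.
Variables (G : set (E * E)) (hG : partial_iso G).

Lemma piso1 : G (1, 1).
Proof. by case: hG => h *; apply: h; case: hM. Qed.

Lemma piso0 : G (0, 0).
Proof. by case: hG => h *; apply: h; case: hM. Qed.

(** For nonzero [x] the pair [(1, 1) - (x^-1, 0) * (x, 0) = (0, 1)] would lie in [G]. *)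
Lemma piso_inj x : G (x, 0) -> x = 0.
Proof.
have G1 := piso1; case: hG => _ GB GM GV G0 Gx; apply/eqP/negPn/negP => x0.
have := GB _ _ G1 (GM _ _ (GV _ Gx) Gx); rewrite /= mulVf // subrr mulr0 subr0.
by move/G0/eqP; rewrite oner_eq0.
Qed.

Lemma piso_fun x y z : G (x, y) -> G (x, z) -> y = z.
Proof.
case: hG => _ GB _ _ G0 Gy Gz; apply/eqP; rewrite -subr_eq0; apply/eqP/G0.
by have := GB _ _ Gy Gz; rewrite /= subrr.
Qed.

Lemma piso_cofun x y z : G (x, z) -> G (y, z) -> x = y.
Proof.
case: (hG) => _ GB _ _ _ Gx Gy; apply/eqP; rewrite -subr_eq0; apply/eqP/piso_inj.
by have := GB _ _ Gx Gy; rewrite /= subrr.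
Qed.

Definition pdom x := exists y, G (x, y).

Lemma pdom_subfield : is_subfield pdom.
Proof.
case: (hG) => GMb GB GM GV _; split.
- by exists 0; apply: piso0.
- by exists 1; apply: piso1.
- by move=> x y [x' Gx] [y' Gy]; exists (x' - y'); apply: (GB (x, x') (y, y')).
- by move=> x y [x' Gx] [y' Gy]; exists (x' * y'); apply: (GM (x, x') (y, y')).
- by move=> x [x' Gx]; exists (x'^-1); apply: (GV (x, x')).
Qed.

(** Turns the graph into a ring morphism on its domain, so that it can be applied to the
    coefficients of polynomials. *)
Lemma piso_rmorph : exists i : {rmorphism sftype pdom_subfield -> E},
  forall a, G (sfval a, i a).
Proof.
pose i (a : sftype pdom_subfield) := projT1 (cid (sfvalP a)).
have iP a : G (sfval a, i a) by apply: (projT2 (cid (sfvalP a))).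
case: (hG) => GMb GB GM GV _.
have iB : zmod_morphism i.
  move=> a b; apply: (@piso_fun (sfval (a - b))); first exact: iP.
  by rewrite rmorphB; apply: (GB (sfval a, i a) (sfval b, i b)).
have iM : monoid_morphism i.
  split=> [|a b]; last first.
    apply: (@piso_fun (sfval (a * b))); first exact: iP.
    by rewrite rmorphM; apply: (GM (sfval a, i a) (sfval b, i b)).
  by apply: (@piso_fun (sfval (1 : sftype pdom_subfield))); [apply: iP|rewrite rmorph1; apply: piso1].
pose A := GRing.isZmodMorphism.Build _ _ i iB.
pose B := GRing.isMonoidMorphism.Build _ _ i iM.
pose f : {rmorphism _ -> _} := HB.pack i A B.
by exists f.
Qed.

End Basics.

(** This is the isomorphism of simple extensions sending [x1] to [x2]: a polynomial over [F] is
    evaluated at both roots. [irreducible_inverse] gives inverses and [irreducible_root_transfer]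
    gives functionality. *)
Lemma piso_adjoin (F : fieldType) (i1 i2 : {rmorphism F -> E}) (P : {poly F}) (x1 x2 : E) :
  irreducible_poly P -> root (map_poly i1 P) x1 -> root (map_poly i2 P) x2 ->
  (forall x, M x -> exists a, i1 a = x /\ i2 a = x) ->
  partial_iso (fun u => exists A, u = ((map_poly i1 A).[x1], (map_poly i2 A).[x2])).
Proof.
move=> irrP r1 r2 hi; split.
- by move=> x /hi[a [ax1 ax2]]; exists a%:P; rewrite !map_polyC !hornerC /= ax1 ax2.
- by move=> _ _ [A ->] [B ->]; exists (A - B); rewrite !rmorphB !hornerD !hornerN.
- by move=> _ _ [A ->] [B ->]; exists (A * B); rewrite !rmorphM !hornerM.
- move=> _ [A ->] /=; have [A0|nz] := eqVneq (map_poly i1 A).[x1] 0.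
    rewrite A0 (irreducible_root_transfer irrP r1 r2 A0) !invr0.
    by exists 0; rewrite !rmorph0 !horner0.
  have [B [AB1 AB2]] := irreducible_inverse irrP r1 r2 nz; exists B.
  have nz2 : (map_poly i2 A).[x2] != 0.
    by apply: contraPneq AB2 => ->; rewrite mul0r => /esym/eqP; rewrite oner_eq0.
  by congr pair; [apply: (mulfI nz)|apply: (mulfI nz2)]; rewrite ?AB1 ?AB2 mulfV.
by move=> y [A [/esym A0 ->]]; apply: (irreducible_root_transfer irrP r1 r2 A0).
Qed.

End ExtendAut.

Section AutOverSubfield.
Variables (E : closedFieldType) (M : E -> Prop) (hM : is_subfield M).
Hypothesis halg : forall x, algebraic_over M x.

(** The irreducible polynomial of [x] over the domain of [G] is transported by [G], and [x] is sent
    to a root of the result, which exists in [E]. *)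
Lemma piso_extend (G : set (E * E)) (x : E) : partial_iso M G ->
  exists G', [/\ partial_iso M G', (G `<=` G')%classic & exists y, G' (x, y)].
Proof.
move=> hG; have hD := pdom_subfield hM hG; have [i2 i2P] := piso_rmorph hM hG.
pose i1 := @sfval _ _ (pdom_subfield hM hG).
have algx : algebraic_over (pdom G) x.
  have [A [A0 [MA rA]]] := halg x; exists A; split=> //; split=> // i.
  by exists A`_i; case: (hG) => + *; apply.
have [P [irrP rP]] := algebraic_sf (pdom_subfield hM hG) algx.
have [x2 rP2] : exists x2, root (map_poly i2 P) x2.
  by apply: closed_rootP; rewrite size_map_poly; case: irrP => h _; rewrite neq_ltn h orbT.
exists (fun u => exists A, u = ((map_poly i1 A).[x], (map_poly i2 A).[x2])); split.
- apply: (piso_adjoin irrP rP rP2) => z Mz.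
  have Gz : G (z, z) by case: (hG) => + *; apply.
  have [a az] : exists a : sftype (pdom_subfield hM hG), sfval a = z.
    by apply: sfval_ex; exists z.
  by exists a; split=> //; apply: (piso_fun hG (i2P a)); rewrite az.
- move=> [u v] Guv.
  have [a au] : exists a : sftype (pdom_subfield hM hG), sfval a = u.
    by apply: sfval_ex; exists v.
  exists a%:P; rewrite !map_polyC !hornerC /= /i1 au; congr pair.
  by apply: (piso_fun hG Guv); rewrite -au.
- by exists x2, 'X; rewrite !map_polyX !hornerX.
Qed.

Lemma piso_total (G : set (E * E)) : partial_iso M G ->
  exists G', [/\ partial_iso M G', (G `<=` G')%classic & forall x, exists y, G' (x, y)].
Proof.
move=> hG.
(* Taking the union with [G] makes the condition hold for the empty chain too and keeps [G] inside
   the maximal element. *)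
pose Q (A : set (E * E)) := partial_iso M (A `|` G)%classic.
have [C CQ|A [QA Amax]] := @Zorn_bigcup _ Q.
  move=> Ctot; rewrite /Q.
  pose U := ((\bigcup_(X in C) X) `|` G)%classic.
  have sub X : C X -> ((X `|` G) `<=` U)%classic.
    by move=> CX u [Xu|Gu]; [left; exists X|right].
  have in2 u v : U u -> U v -> exists H, [/\ partial_iso M H, (H `<=` U)%classic, H u & H v].
    have base : partial_iso M G /\ (G `<=` U)%classic by split=> // z Gz; right.
    case=> [[X CX Xu]|Gu] [[Y CY Yv]|Gv].
    - have [XY|YX] := Ctot _ _ CX CY.
        by exists (Y `|` G)%classic; split; [exact: CQ|exact: sub|left; apply: XY|left].
      by exists (X `|` G)%classic; split; [exact: CQ|exact: sub|left|left; apply: YX].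
    - by exists (X `|` G)%classic; split; [exact: CQ|exact: sub|left|right].
    - by exists (Y `|` G)%classic; split; [exact: CQ|exact: sub|right|left].
    - by exists G; case: base.
  split.
  - by move=> x Mx; right; case: (hG) => + *; apply.
  - by move=> u v Uu Uv; have [H [[_ h _ _ _] HU Hu Hv]] := in2 _ _ Uu Uv; apply: HU; apply: h.
  - by move=> u v Uu Uv; have [H [[_ _ h _ _] HU Hu Hv]] := in2 _ _ Uu Uv; apply: HU; apply: h.
  - by move=> u Uu; have [H [[_ _ _ h _] HU Hu _]] := in2 _ _ Uu Uu; apply: HU; apply: h.
  - by move=> y Uu; have [H [[_ _ _ _ h] HU Hu _]] := in2 _ _ Uu Uu; apply: h.
exists (A `|` G)%classic; split=> // x.
have [G' [hG' sG' xG']] := piso_extend x QA.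
case: xG' => y Gxy; exists y.
have [//|nxy] := pselect ((A `|` G)%classic (x, y)); exfalso.
apply: (Amax G'); last first.
  by rewrite /Q (_ : (G' `|` G)%classic = G') //; apply: setUidl => u Gu; apply: sG'; right.
split; first by move=> u Au; apply: sG'; left.
by move=> h; apply: nxy; left; apply: h.
Qed.

Lemma aut_of_piso (G : set (E * E)) : partial_iso M G ->
  exists s, in_Gal M s /\ forall x y, G (x, y) -> s x = y.
Proof.
move=> /piso_total[G' [hG' sG' tot]].
pose s x := projT1 (cid (tot x)).
have sP x : G' (x, s x) by apply: (projT2 (cid (tot x))).
have sE x y : G' (x, y) -> s x = y by move=> h; apply: (piso_fun hG' (sP x) h).
case: (hG') => GM GB GMu GV G0.
have s0 : s 0 = 0 by apply: sE; apply: (piso0 hM hG').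
have sB x y : s (x - y) = s x - s y by apply: sE; apply: (GB (x, s x) (y, s y)).
have sN x : s (- x) = - s x by rewrite -[- x]sub0r sB s0 sub0r.
have sD x y : s (x + y) = s x + s y by rewrite -{1}[y]opprK sB sN opprK.
have sM x y : s (x * y) = s x * s y by apply: sE; apply: (GMu (x, s x) (y, s y)).
have s1 : s 1 = 1 by apply: sE; apply: (piso1 hM hG').
have sfix x : M x -> s x = x by move=> Mx; apply: sE; apply: GM.
have sinj : injective s.
  by move=> x y sxy; apply: (piso_cofun hM hG' (sP x)); rewrite sxy.
exists s; split; last by move=> x y /sG'; apply: sE.
split=> //; split=> //.
(* [s] maps the finite set of roots of a polynomial over [M] injectively into itself, hence onto
   itself. *)
have surj y : exists x, s x == y.
  have [A [A0 [MA rA]]] := halg y.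
  have [rs AE] := closed_field_poly_normal A.
  have lc0 : lead_coef A != 0 by rewrite lead_coef_eq0.
  have sH x : s A.[x] = A.[s x].
    have sX n : s (x ^+ n) = s x ^+ n by elim: n => [|n IH] //; rewrite !exprS sM IH.
    rewrite !horner_coef; elim/big_ind2: _ => // [u v u' v' <- <-|i _]; first exact: sD.
    by rewrite sM sX sfix.
  have inrs x : (x \in rs) = root A x.
    by rewrite AE rootZ // root_prod_XsubC.
  have sub : {subset map s (undup rs) <= undup rs}.
    move=> _ /mapP[x + ->]; rewrite !mem_undup !inrs => /rootP r.
    by apply/rootP; rewrite -sH r s0.
  have um : uniq (map s (undup rs)) by rewrite map_inj_uniq // undup_uniq.
  have [_ /(_ y)] := uniq_min_size um sub (eq_leq (esym (size_map _ _))).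
  rewrite mem_undup inrs rA => /mapP[x _ ->]; by exists x.
pose t y := xchoose (surj y).
by exists t => x; [apply: sinj|]; apply/eqP/(xchooseP (surj _)).
Qed.

(** Every root of the irreducible polynomial of [w] is a Galois image of [w], so all roots equal
    [w]. The second highest coefficient then puts a multiple [n w] in [M], and [n] is invertible in
    characteristic 0. *)
Lemma fixed_by_Gal (char0 : forall n : nat, n.+1%:R != 0 :> E) w :
  (forall s, in_Gal M s -> s w = w) -> M w.
Proof.
move=> fixw; have [P [irrP rP]] := algebraic_sf hM (halg w).
set i := @sfval _ _ hM; set Q := map_poly i P.
have hi x : M x -> exists a, i a = x /\ i a = x by case/(sfval_ex hM)=> a ai; exists a.
have conj w' : root Q w' -> w' = w.
  move=> rw'; have := piso_adjoin irrP rP rw' hi => /aut_of_piso[s [sG sE]].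
  rewrite -(fixw _ sG); apply/esym/sE; exists 'X; by rewrite !map_polyX !hornerX.
have [rs QE] := closed_field_poly_normal Q.
have lcQ : lead_coef Q != 0 by rewrite lead_coef_eq0 map_poly_eq0; apply: irredp_neq0.
have rsE : rs = nseq (size rs) w.
  apply/all_pred1P/allP => z zrs; apply/eqP/conj.
  by rewrite QE rootZ // root_prod_XsubC.
have MQ j : M Q`_j by rewrite coef_map; apply: sfvalP.
have sQ : size Q = (size rs).+1.
  by rewrite QE size_scale // size_prod_XsubC.
have n0 : (0 < size rs)%N.
  by rewrite -ltnS -sQ size_map_poly; case: irrP.
case: (hM) => M0 M1 MB MM MV.
have Mn (n : nat) : M n%:R := subfield_nat hM n.
have := MQ (size rs).-1.
rewrite QE coefZ coefPn_prod_XsubC ?lt0n_neq0 // rsE.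
set S := \sum_(z <- _) z.
have -> : S = (size rs)%:R * w.
  by rewrite /S big_nseq iter_addr_0 mulr_natl.
move=> h.
have lcM : M (lead_coef Q) by apply: MQ.
have nzn : (size rs)%:R != 0 :> E by case: (size rs) n0 => // n _; apply: char0.
have -> : w = (lead_coef Q)^-1 * (size rs)%:R^-1 * (- (lead_coef Q * - ((size rs)%:R * w))).
  by field; rewrite nzn lcQ.
by apply: (MM); [apply: (MM); apply: (MV)|apply: subfieldN].
Qed.

End AutOverSubfield.
(** * Non-archimedean absolute values and torsion of value groups *)

Section AbsoluteValue.
Variables (R : realFieldType) (E : fieldType) (av : E -> R).
Hypothesis hav : nonarch_abs av.

Lemma av_ge0 x : 0 <= av x. Proof. by case: hav => h *; apply: h. Qed.
Lemma av0 : av 0 = 0. Proof. by case: hav => _ h _ _; apply/h. Qed.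
Lemma avM x y : av (x * y) = av x * av y. Proof. by case: hav => _ _ h _; apply: h. Qed.
Lemma avD x y : av (x + y) <= Num.max (av x) (av y).
Proof. by case: hav => _ _ _ h; apply: h. Qed.

Lemma av_eq0 x : (av x == 0) = (x == 0).
Proof. by apply/eqP/eqP; case: hav => _ h _ _; apply: (h x).1 || apply: (h x).2. Qed.

Lemma av_gt0 x : (0 < av x) = (x != 0).
Proof. by rewrite lt0r av_eq0 av_ge0 andbT. Qed.

Lemma av1 : av 1 = 1.
Proof.
have nz : av 1 != 0 by rewrite av_eq0 oner_eq0.
by apply: (mulfI nz); rewrite -avM !mulr1.
Qed.

Lemma avX x n : av (x ^+ n) = av x ^+ n.
Proof. by elim: n => [|n IH]; rewrite ?av1 // !exprS avM IH. Qed.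

Lemma avN x : av (- x) = av x.
Proof.
suff -> : - x = (- 1) * x.
  rewrite avM; have : av (-1) ^+ 2 = 1 by rewrite -avX sqrrN expr1n av1.
  by move/eqP; rewrite sqrp_eq1 ?av_ge0 // => /eqP ->; rewrite mul1r.
by rewrite mulN1r.
Qed.

Lemma avV x : av x^-1 = (av x)^-1.
Proof.
have [->|nz] := eqVneq x 0; first by rewrite invr0 av0 invr0.
have nz' : av x != 0 by rewrite av_eq0.
by apply: (mulfI nz'); rewrite -avM !mulfV // av1.
Qed.

Lemma av_div x y : av (x / y) = av x / av y. Proof. by rewrite avM avV. Qed.

Lemma avBC x y : av (x - y) = av (y - x). Proof. by rewrite -avN opprB. Qed.

Lemma avD_le c x y : av x <= c -> av y <= c -> av (x + y) <= c.
Proof. by move=> hx hy; apply: le_trans (avD x y) _; rewrite ge_max hx. Qed.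
Lemma avD_lt c x y : av x < c -> av y < c -> av (x + y) < c.
Proof. by move=> hx hy; apply: le_lt_trans (avD x y) _; rewrite gt_max hx. Qed.
Lemma avB_le c x y : av x <= c -> av y <= c -> av (x - y) <= c.
Proof. by move=> hx hy; apply: avD_le; rewrite ?avN. Qed.
Lemma avB_lt c x y : av x < c -> av y < c -> av (x - y) < c.
Proof. by move=> hx hy; apply: avD_lt; rewrite ?avN. Qed.

Lemma av_sum_le c (I : Type) (r : seq I) (P : pred I) (F : I -> E) :
  0 <= c -> (forall i, P i -> av (F i) <= c) -> av (\sum_(i <- r | P i) F i) <= c.
Proof.
move=> c0 h; elim/big_ind: _ => //; first by rewrite av0.
exact: avD_le.
Qed.
Lemma av_sum_lt c (I : Type) (r : seq I) (P : pred I) (F : I -> E) :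
  0 < c -> (forall i, P i -> av (F i) < c) -> av (\sum_(i <- r | P i) F i) < c.
Proof.
move=> c0 h; elim/big_ind: _ => //; first by rewrite av0.
exact: avD_lt.
Qed.

Lemma av_prod (I : Type) (r : seq I) (P : pred I) (F : I -> E) :
  av (\prod_(i <- r | P i) F i) = \prod_(i <- r | P i) av (F i).
Proof. by apply: (big_morph av avM av1). Qed.

Lemma av_dom x y : av y < av x -> av (x + y) = av x.
Proof.
move=> lt; apply/eqP; rewrite eq_le avD_le ?(ltW lt) //= leNgt; apply/negP => h.
by have := avB_lt h lt; rewrite addrK ltxx.
Qed.

Lemma av_close x y : av (x - y) < av x -> av x = av y.
Proof. by move=> h; rewrite -[in RHS](subrK x y) addrC av_dom // avBC. Qed.

Lemma av_mul_lt1 x y : av x < 1 -> av y <= 1 -> av (x * y) < 1.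
Proof.
move=> hx hy; rewrite avM; have [->|nz] := eqVneq (av y) 0; first by rewrite mulr0.
by apply: lt_le_trans hy; rewrite gtr_pMl // lt0r nz av_ge0.
Qed.
Lemma av_mul_le1 x y : av x <= 1 -> av y <= 1 -> av (x * y) <= 1.
Proof. by move=> hx hy; rewrite avM mulr_ile1 ?av_ge0. Qed.

Lemma av_nat n : av n%:R <= 1.
Proof. by elim: n => [|n IH]; rewrite ?av0 // -natr1 avD_le ?av1. Qed.

(** In a vanishing sum the largest absolute value is attained at least twice; this is the Newton
    polygon argument. *)
Lemma av_root_eq (P : {poly E}) x : P != 0 -> root P x -> x != 0 ->
  exists i j : nat, [/\ (i < j < size P)%N, P`_i != 0, P`_j != 0 &
    av P`_i * av x ^+ i = av P`_j * av x ^+ j].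
Proof.
move=> P0 rP x0.
pose t (i : 'I_(size P)) := av (P`_i * x ^+ i).
have sP : (0 < size P)%N by rewrite size_poly_gt0.
pose m := [arg max_(i > Ordinal sP) t i]%O.
have mmax i : t i <= t m by rewrite /m; case: arg_maxP => // k _ h; apply: h.
have tm : 0 < t m.
  have hl : ((size P).-1 < size P)%N by rewrite prednK.
  apply: lt_le_trans (mmax (Ordinal hl)).
  by rewrite /t av_gt0 mulf_neq0 ?expf_neq0 //= -lead_coefE lead_coef_eq0.
have [k km tk] : exists2 k, k != m & t k = t m.
  have [[k km tk]|h] := pselect (exists2 k, k != m & t k = t m); first by exists k.
  exfalso; have := rootP rP; rewrite horner_coef (bigD1 m) //=.
  set s := \sum_(i < _ | _) _ => h0.
  have : av s < t m.
    apply: av_sum_lt => // i im; rewrite lt_neqAle mmax andbT.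
    by apply/eqP => e; apply: h; exists i.
  rewrite (_ : s = - (P`_m * x ^+ m)) ?avN ?ltxx //.
  by apply/eqP; rewrite -subr_eq0 opprK addrC h0.
have nz i : t i = t m -> P`_i != 0.
  by move=> e; apply: contraTneq tm => z; rewrite -e /t z mul0r av0 ltxx.
move: km; rewrite neq_ltn => /orP[] lt.
- exists k, m; split; rewrite ?lt ?nz //=.
  by rewrite -!avX -!avM.
- exists m, k; split; rewrite ?lt ?nz //=.
  by rewrite -!avX -!avM.
Qed.

(** The two dominant terms of a linear relation between powers of [x] are compared. The bound on [k]
    is uniform in [x]. *)
Lemma av_finite_ext (S L : E -> Prop) (b : seq E) :
  is_subfield S ->
  (forall x, L x -> exists c : nat -> E, (forall i, S (c i)) /\
      x = \sum_(i < size b) c i * b`_i) ->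
  forall x, (forall k, L (x ^+ k)) -> x != 0 ->
  exists k c, [/\ (0 < k <= size b)%N, S c, c != 0 & av x ^+ k = av c].
Proof.
move=> hS hb x Lx x0; have [P [P0 SP szP rP]] := finite_over_root hS hb Lx.
have [i [j [/andP[lij ljP] Pi Pj e]]] := av_root_eq P0 rP x0.
case: (hS) => S0 S1 SB SM SV.
exists (j - i)%N, (P`_i / P`_j); split.
- by rewrite subn_gt0 lij /=; move: (leq_trans ljP szP); rewrite ltnS; apply: leq_trans; rewrite leq_subr.
- by apply: (SM) => //; apply: (SV).
- by rewrite mulf_neq0 ?invr_eq0.
have ax i' : av x ^+ i' != 0 by rewrite expf_neq0 // av_eq0.
have aj : av P`_j != 0 by rewrite av_eq0.
apply: (mulfI (ax i)); rewrite -exprD subnKC ?(ltnW lij) //.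
by by apply: (mulfI aj); rewrite -e av_div; field.
Qed.

Section Closure.
Variables (Z : R -> Prop).
Hypothesis Z1 : exists2 e, Z e & 0 < e <= 1.
Hypothesis Zpos : forall e, Z e -> 0 < e.
Hypothesis Zscale : forall e x, Z e -> exists2 e', Z e' & e' * av x < e.

(** The radii [Z] are a parameter because two choices occur: all positive elements of [R] for
    [Qp_in], and the powers of [1/p] for the maximal extension. *)
Definition avclosure (S : E -> Prop) x := forall e, Z e -> exists2 y, S y & av (x - y) < e.

Lemma avclosure_base S x : S x -> avclosure S x.
Proof. by move=> Sx e /Zpos e0; exists x => //; rewrite subrr av0. Qed.

(** An approximation closer to [x] than [av x] has the same value, and [Zscale] at [x^-1] provides
    such a radius. So the closure has no new values. *)
Lemma avclosure_val S x : avclosure S x -> x != 0 -> exists2 y, S y & av x = av y.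
Proof.
move=> hx x0; have [e Ze /andP[e0 e1]] := Z1.
have [e' Ze' h] := Zscale x^-1 Ze; have [y Sy hy] := hx _ Ze'.
exists y => //; apply: av_close; apply: lt_trans hy _.
have /(lt_le_trans h) := e1; rewrite avV ltr_pdivrMr ?av_gt0 //.
by rewrite mul1r.
Qed.

Lemma avclosure_subfield S : is_subfield S -> is_subfield (avclosure S).
Proof.
move=> hS; case: (hS) => S0 S1 SB SM SV.
split; [exact: avclosure_base|exact: avclosure_base| | |].
- move=> x y hx hy e Ze; have [x' Sx' lx] := hx _ Ze; have [y' Sy' ly] := hy _ Ze.
  exists (x' - y'); first exact: SB.
  by rewrite (_ : _ - _ = (x - x') - (y - y')); [apply: avB_lt|ring].
- move=> x y hx hy e Ze.
  have [e1 Ze1 h1] := Zscale x Ze; have [y' Sy' ly] := hy _ Ze1.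
  have [e2 Ze2 h2] := Zscale y' Ze; have [x' Sx' lx] := hx _ Ze2.
  exists (x' * y'); first exact: SM.
  rewrite (_ : _ - _ = (y - y') * x + (x - x') * y'); last by ring.
  apply: avD_lt; rewrite avM.
    by apply: le_lt_trans h1; rewrite ler_wpM2r ?av_ge0 // ltW.
  by apply: le_lt_trans h2; rewrite ler_wpM2r ?av_ge0 // ltW.
- move=> x hx; have [->|x0] := eqVneq x 0; first by rewrite invr0; apply: avclosure_base.
  move=> e Ze; have [e0 Ze0 /andP[e00 e01]] := Z1.
  (* The radius [e1] forces [av y = av x]; the inverses are then at distance
     [av (x - y) / av x ^+ 2], which [e2] controls. *)
  have [e1 Ze1 h1] := Zscale x^-1 Ze0; have [e2 Ze2 h2] := Zscale (x^-1 ^+ 2) Ze.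
  have [e3 [Ze3 e31 e32]] : exists e3, [/\ Z e3, e3 <= e1 & e3 <= e2].
    by case: (lerP e1 e2) => h; [exists e1|exists e2; rewrite ltW].
  have [y Sy ly] := hx _ Ze3.
  have axy : av x = av y.
    apply: av_close; apply: lt_le_trans ly _; apply: le_trans e31 _.
    have /(lt_le_trans h1) := e01; rewrite avV ltr_pdivrMr ?av_gt0 // mul1r.
    exact: ltW.
  have y0 : y != 0 by rewrite -av_eq0 -axy av_eq0.
  exists y^-1; first exact: SV.
  rewrite (_ : _ - _ = (y - x) / (x * y)); last by field; rewrite y0.
  rewrite av_div avM -axy -avM -expr2 -avV -exprVn avBC.
  apply: le_lt_trans h2; rewrite ler_wpM2r ?av_ge0 //.
  exact: le_trans (ltW ly) _.
Qed.

End Closure.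

Section Padic.
Variable p : nat.
Hypotheses (hp : prime p) (hpadic : padic_on_nat av p).
Local Notation q := (p%:R : R).

Lemma p_gt1 : 1 < q. Proof. by rewrite ltr1n prime_gt1. Qed.
Lemma p_gt0 : 0 < q. Proof. exact: lt_trans p_gt1. Qed.

Lemma av_p : av p%:R = q^-1.
Proof. by rewrite hpadic ?prime_gt0 // -[X in logn _ X]expn1 pfactorK // expr1. Qed.

Lemma av_small_nat n : (0 < n < p)%N -> av n%:R = 1.
Proof.
case/andP=> n0 np; rewrite hpadic // (_ : logn p n = 0%N) ?expr0 ?invr1 //.
by apply/eqP; rewrite -leqn0 leqNgt logn_gt0 mem_primes hp n0 /=; apply/negP => /dvdn_leq; rewrite n0 leqNgt np; move/(_ isT).
Qed.

Lemma padic_char0 n : n.+1%:R != 0 :> E.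
Proof. by rewrite -av_eq0 hpadic // invr_eq0 expf_neq0 // gt_eqF ?p_gt0. Qed.

Lemma q_exp_lt (a b : int) : (q ^ a < q ^ b) = (a < b).
Proof. by rewrite ltr_eXz2l // p_gt1. Qed.
Lemma q_exp_inj (a b : int) : q ^ a = q ^ b -> a = b.
Proof. by apply: ieexprIz; rewrite ?p_gt0 // gt_eqF ?p_gt1. Qed.
Lemma q_exp_gt0 (a : int) : 0 < q ^ a.
Proof. by rewrite exprz_gt0 // p_gt0. Qed.
Lemma q_neq0 : q != 0. Proof. by rewrite gt_eqF ?p_gt0. Qed.

(** Plays the part of a finite ramification index: [h] kills the value group of [S] modulo the
    powers of [p]. *)
Definition torsion (h : nat) (S : E -> Prop) : Prop :=
  (0 < h)%N /\ forall c, S c -> c != 0 -> exists a : int, av c ^+ h = q ^ a.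

(** The exponent [k] varies with [x] but is at most [size b], so the factorial of [size b] serves
    for all [x]. *)
Lemma torsion_finite (S L : E -> Prop) h : is_subfield S -> is_subfield L ->
  finite_over S L -> torsion h S -> exists h', torsion h' L.
Proof.
move=> hS hL [b hb] [h0 hh]; exists (h * (size b)`!)%N; split.
  by rewrite muln_gt0 h0 fact_gt0.
move=> x Lx x0; have LX k : L (x ^+ k) := subfieldX hL k Lx.
have [k [c [/andP[k0 kb] Sc c0 e]]] := av_finite_ext hS hb LX x0.
have [a ea] := hh _ Sc c0.
have : (k %| (size b)`!)%N by rewrite dvdn_fact // k0.
case/dvdnP=> m ->; exists (a * m%:Z); rewrite (_ : (h * (m * k) = k * (h * m))%N); last by ring.
by rewrite exprM e exprM ea exprnP exprz_exp.
Qed.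

Definition fractions (x : E) : Prop :=
  exists m n : int, n%:~R != 0 :> E /\ x = m%:~R / n%:~R.

Lemma fractions_subfield : is_subfield fractions.
Proof.
split.
- by exists 0, 1; rewrite oner_eq0 mul0r.
- by exists 1, 1; rewrite oner_eq0 divr1.
- move=> _ _ [m [n [n0 ->]]] [m' [n' [n0' ->]]].
  exists (m * n' - m' * n), (n * n'); rewrite !rmorphM rmorphB !rmorphM /= mulf_neq0 //; split=> //.
  by field; rewrite n0 n0'.
- move=> _ _ [m [n [n0 ->]]] [m' [n' [n0' ->]]].
  exists (m * m'), (n * n'); rewrite !rmorphM /= mulf_neq0 //; split=> //.
  by field; rewrite n0 n0'.
- move=> _ [m [n [n0 ->]]]; have [m0|m0] := eqVneq (m%:~R : E) 0.
    by exists 0, 1; rewrite m0 mul0r invr0 mul0r oner_eq0.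
  by exists n, m; split=> //; rewrite invf_div.
Qed.

Lemma torsion_int (m : int) : m%:~R != 0 :> E -> exists a : int, av m%:~R = q ^ a.
Proof.
suff h n : n%:R != 0 :> E -> exists a : int, av n%:R = q ^ a.
  by case: m => n; [apply: (h n)|rewrite NegzE mulrNz avN oppr_eq0; apply: (h n.+1)].
case: n => [|n _]; first by rewrite eqxx.
by exists (- (logn p n.+1)%:Z); rewrite hpadic // -exprnN.
Qed.

Lemma torsion_fractions : torsion 1 fractions.
Proof.
split=> // _ [m [n [n0 ->]]]; rewrite mulf_eq0 invr_eq0 negb_or => /andP[m0 _].
have [a ea] := torsion_int m0; have [b eb] := torsion_int n0.
by exists (a - b); rewrite expr1 av_div ea eb expfzDr ?q_neq0 // invr_expz.
Qed.

Definition Rpos (e : R) := 0 < e.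

Lemma Rpos1 : exists2 e, Rpos e & 0 < e <= 1.
Proof. by exists 1; rewrite /Rpos ?ltr01 ?lexx. Qed.
Lemma Rpos_scale e x : Rpos e -> exists2 e', Rpos e' & e' * av x < e.
Proof.
move=> e0; have h : 0 < av x + 1 by rewrite ltr_wpDl ?av_ge0.
exists (e / (av x + 1)); first by rewrite /Rpos divr_gt0.
by rewrite mulrAC ltr_pdivrMr // ltr_pM2l // ltrDl.
Qed.

Lemma Qp_fractions x : Qp_in av x -> avclosure Rpos fractions x.
Proof.
move=> hx e e0; have [r hr] := hx _ e0; exists (ratr r) => //.
exists (numq r), (denq r); split=> //.
have := denq_gt0 r; case: (denq r) => // -[|n] // _.
exact: padic_char0.
Qed.

Lemma torsion_avclosure Z h S : (exists2 e, Z e & 0 < e <= 1) ->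
  (forall e x, Z e -> exists2 e', Z e' & e' * av x < e) ->
  torsion h S -> torsion h (avclosure Z S).
Proof.
move=> Z1 Zs [h0 hh]; split=> // x hx x0.
have [y Sy xy] := avclosure_val Z1 Zs hx x0.
by rewrite xy; apply: hh => //; rewrite -av_eq0 -xy av_eq0.
Qed.

(** The values of rational numbers are powers of [p], the closure adds no values, and a finite
    extension keeps the exponent bounded. *)
Lemma torsion_over_Qp K : is_subfield K -> finite_over (Qp_in av) K ->
  exists h, torsion h K.
Proof.
move=> hK [b hb].
have hC : is_subfield (avclosure Rpos fractions).
  by apply: (avclosure_subfield Rpos1 _ Rpos_scale) => //; apply: fractions_subfield.
apply: (torsion_finite hC hK _ (torsion_avclosure Rpos1 Rpos_scale torsion_fractions)).
exists b => x /hb[c [hc ->]]; exists c; split=> // i; exact: Qp_fractions.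
Qed.

End Padic.
End AbsoluteValue.
(** * Maximal unramified extensions and inertia *)

Section FieldAut.
Variables (E : fieldType) (s : E -> E) (hs : field_aut s).

Lemma autD x y : s (x + y) = s x + s y. Proof. by case: hs. Qed.
Lemma autM x y : s (x * y) = s x * s y. Proof. by case: hs. Qed.
Lemma aut1 : s 1 = 1. Proof. by case: hs. Qed.
Lemma aut_inj : injective s. Proof. by case: hs => _ _ _ /bij_inj. Qed.
Lemma aut0 : s 0 = 0.
Proof. by apply: (@addrI _ (s 0)); rewrite -autD !addr0. Qed.
Lemma autN x : s (- x) = - s x.
Proof. by apply: (@addrI _ (s x)); rewrite -autD !subrr aut0. Qed.
Lemma autB x y : s (x - y) = s x - s y. Proof. by rewrite autD autN. Qed.
Lemma aut_eq0 x : (s x == 0) = (x == 0). Proof. by rewrite -[in LHS]aut0 (inj_eq aut_inj). Qed.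
Lemma autV x : s x^-1 = (s x)^-1.
Proof.
have [->|x0] := eqVneq x 0; first by rewrite invr0 aut0 invr0.
have sx0 : s x != 0 by rewrite aut_eq0.
by apply: (mulfI sx0); rewrite -autM !mulfV // aut1.
Qed.
Lemma aut_div x y : s (x / y) = s x / s y. Proof. by rewrite autM autV. Qed.
Lemma autX x n : s (x ^+ n) = s x ^+ n.
Proof. by elim: n => [|n IH]; rewrite ?aut1 // !exprS autM IH. Qed.
Lemma aut_exprz x (a : int) : s (x ^ a) = s x ^ a.
Proof.
case: a => n; first by rewrite -!exprnP autX.
by rewrite NegzE -!exprnN autV autX.
Qed.
Lemma aut_nat n : s n%:R = n%:R.
Proof. by elim: n => [|n IH]; rewrite ?aut0 // -!natr1 autD IH aut1. Qed.
Lemma aut_prod (I : Type) (r : seq I) (P : pred I) (F : I -> E) :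
  s (\prod_(i <- r | P i) F i) = \prod_(i <- r | P i) s (F i).
Proof. exact: (big_morph s autM aut1). Qed.
Lemma aut_sum (I : Type) (r : seq I) (P : pred I) (F : I -> E) :
  s (\sum_(i <- r | P i) F i) = \sum_(i <- r | P i) s (F i).
Proof. exact: (big_morph s autD aut0). Qed.
Lemma aut_horner (A : {poly E}) x : (forall i, s A`_i = A`_i) -> s A.[x] = A.[s x].
Proof.
by move=> h; rewrite !horner_coef aut_sum; apply: eq_bigr => i _; rewrite autM autX h.
Qed.
End FieldAut.

(** * Maximal extensions without new values *)

Section Unramified.
Variables (R : realFieldType) (E : closedFieldType) (av : E -> R) (p : nat).
Hypotheses (hav : nonarch_abs av) (hp : prime p) (hpadic : padic_on_nat av p).
Local Notation q := (p%:R : R).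

(** Two dominant terms of an equation for [x] make a power of [av x] a value of [L]. Here the
    exponent depends on [x]. *)
Lemma torsion_alg (L : E -> Prop) h x : is_subfield L -> torsion av p h L ->
  algebraic_over L x -> x != 0 ->
  exists2 k, (0 < k)%N & exists a : int, av x ^+ k = q ^ a.
Proof.
move=> [L0 L1 LB LM LV] [h0 hh] [P [P0 [LP rP]]] x0.
have [i [j [/andP[lij ljP] Pi Pj e]]] := av_root_eq hav P0 rP x0.
have [a ea] : exists a : int, av (P`_i / P`_j) ^+ h = q ^ a.
  by apply: hh; [apply: (LM) => //; apply: (LV)|rewrite mulf_neq0 ?invr_eq0].
exists ((j - i) * h)%N; first by rewrite muln_gt0 subn_gt0 lij.
exists a; rewrite -ea exprM; congr (_ ^+ _).
have ax : av x ^+ i != 0 by rewrite expf_neq0 // av_eq0.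
have aj : av P`_j != 0 by rewrite av_eq0.
apply: (mulfI ax); rewrite -exprD subnKC ?(ltnW lij) //.
by apply: (mulfI aj); rewrite -e av_div //; field.
Qed.

Hypothesis htors : forall x, x != 0 -> exists2 k, (0 < k)%N & exists a : int, av x ^+ k = q ^ a.

Let q1 : 1 < q := p_gt1 R hp.
Let q0 : 0 < q := p_gt0 R hp.

(** The Archimedean property for values: if [av x] exceeds 1, it is at most one of its powers that
    is a power of [p]. *)
Lemma av_bound x : exists n : nat, av x < q ^+ n.
Proof.
have [h|h] := lerP (av x) 1; first by exists 1%N; rewrite expr1; apply: le_lt_trans h q1.
have x0 : x != 0 by apply: contraTneq h => ->; rewrite av0 // ltr10.
have [k k0 [a ea]] := htors x0.
exists `|a|.+1%N; apply: (@le_lt_trans _ _ (av x ^+ k)).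
  by rewrite -[X in X <= _]expr1 ler_weXn2l // ltW.
by rewrite ea exprnP q_exp_lt //; lia.
Qed.

(* [R] need not be archimedean: limits are taken along the powers of [1/p]. *)
Definition qpow (e : R) := exists k : nat, e = q ^- k.

Lemma qpow_gt0 e : qpow e -> 0 < e.
Proof. by case=> k ->; rewrite invr_gt0 exprn_gt0. Qed.
Lemma qpow1 : exists2 e, qpow e & 0 < e <= 1.
Proof. by exists 1; [exists 0%N; rewrite expr0 invr1|rewrite ltr01 lexx]. Qed.
Lemma qpow_scale e x : qpow e -> exists2 e', qpow e' & e' * av x < e.
Proof.
case=> k ->; have [n hn] := av_bound x; exists (q ^- (n + k)); first by exists (n + k)%N.
by rewrite exprD invfM mulrAC gtr_pMl ?invr_gt0 ?exprn_gt0 // mulrC ltr_pdivrMr ?exprn_gt0 // mul1r.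
Qed.

Lemma av_max_coef (A : {poly E}) : A != 0 ->
  exists m : nat, A`_m != 0 /\ forall i, av A`_i <= av A`_m.
Proof.
move=> A0; have sP : (0 < size A)%N by rewrite size_poly_gt0.
pose t (i : 'I_(size A)) := av A`_i.
pose m := [arg max_(i > Ordinal sP) t i]%O.
have mmax i : t i <= t m by rewrite /m; case: arg_maxP => // k _ h; apply: h.
have hm i : av A`_i <= av A`_m.
  have [h|h] := ltnP i (size A); first exact: (mmax (Ordinal h)).
  by rewrite nth_default // av0 // av_ge0.
exists m; split=> //; rewrite -(av_eq0 hav) gt_eqF //.
by apply: lt_le_trans (hm (size A).-1); rewrite av_gt0 // -lead_coefE lead_coef_eq0.
Qed.

Lemma av_horner_le1 (A : {poly E}) x : (forall i, av A`_i <= 1) -> av x <= 1 -> av A.[x] <= 1.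
Proof.
move=> hA hx; rewrite horner_coef; apply: av_sum_le => // i _.
by apply: av_mul_le1 => //; rewrite avX // exprn_ile1 ?av_ge0.
Qed.

Lemma av_horner_lt1 (A : {poly E}) x : (forall i, av A`_i < 1) -> av x <= 1 -> av A.[x] < 1.
Proof.
move=> hA hx; rewrite horner_coef; apply: av_sum_lt => // i _.
by apply: av_mul_lt1 => //; rewrite avX // exprn_ile1 ?av_ge0.
Qed.

Lemma av_horner_close (A : {poly E}) x y : (forall i, av A`_i <= 1) -> av x <= 1 -> av y <= 1 ->
  av (x - y) < 1 -> av (A.[x] - A.[y]) < 1.
Proof.
move=> hA hx hy hxy; rewrite !horner_coef -sumrB; apply: av_sum_lt => // i _.
rewrite -mulrBr subrXX mulrC mulrAC -mulrA; apply: av_mul_lt1 => //.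
rewrite mulrC; apply: av_mul_le1 => //; apply: av_sum_le => // j _.
by apply: av_mul_le1 => //; rewrite avX // exprn_ile1 ?av_ge0.
Qed.

Section MaximalUnramified.
Variables (L : E -> Prop) (hL : is_subfield L).
Hypothesis halg : forall x, algebraic_over L x.

(** Only the growth of the value group is excluded: the residue extension is arbitrary and the
    degree may be infinite. *)
Definition unramified_over (M : E -> Prop) : Prop :=
  [/\ is_subfield M, forall x, L x -> M x &
      forall x, M x -> x != 0 -> exists2 l, L l & av x = av l].

Lemma maximal_unramified : exists M, unramified_over M /\
  forall M', unramified_over M' -> (forall x, M x -> M' x) -> forall x, M' x -> M x.
Proof.
pose Q (A : set E) := A = set0 \/ unramified_over A.
have [C CQ Ctot|A [QA Amax]] := @Zorn_bigcup _ Q.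
  have [[X0 CX0 uX0]|no] := pselect (exists2 X : set E, C X & unramified_over X); last first.
    left; rewrite predeqE => x; split=> // -[X CX Xx].
    have [X0|uX] := CQ _ CX; first by rewrite X0 in Xx.
    by apply: no; exists X.
  right; set U := (\bigcup_(X in C) X)%classic.
  have in2 x y : U x -> U y -> exists X, [/\ unramified_over X, C X, X x & X y].
    have h X z : C X -> X z -> unramified_over X.
      by move=> /CQ[-> //|].
    move=> [X CX Xx] [Y CY Yy]; have [XY|YX] := Ctot _ _ CX CY.
      by exists Y; split=> //; [apply: h CY Yy|apply: XY].
    by exists X; split=> //; [apply: h CX Xx|apply: YX].
  have LU x : L x -> U x by move=> Lx; exists X0 => //; case: uX0 => _ + _; apply.
  split=> //.
  - split.
    + by apply: LU; case: hL.
    + by apply: LU; case: hL.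
    + move=> x y Ux Uy; have [X [[[_ _ XB _ _] _ _] CX Xx Xy]] := in2 _ _ Ux Uy.
      by exists X => //; apply: XB.
    + move=> x y Ux Uy; have [X [[[_ _ _ XM _] _ _] CX Xx Xy]] := in2 _ _ Ux Uy.
      by exists X => //; apply: XM.
    + move=> x Ux; have [X [[[_ _ _ _ XV] _ _] CX Xx _]] := in2 _ _ Ux Ux.
      by exists X => //; apply: XV.
  - move=> x Ux; have [X [[_ _ XL] CX Xx _]] := in2 _ _ Ux Ux; exact: XL.
have uL : unramified_over L by split=> // x Lx _; exists x.
have uA : unramified_over A.
  case: QA => // A0; exfalso; apply: (Amax L); last by right.
  by rewrite A0; split=> // /(_ 0); apply; case: hL.
exists A; split=> // M' uM' AM x M'x; have [//|nAx] := pselect (A x); exfalso.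
apply: (Amax M'); last by right.
by split=> // /(_ _ M'x).
Qed.

Variable M : E -> Prop.
Hypotheses (uM : unramified_over M)
  (maxM : forall M', unramified_over M' -> (forall x, M x -> M' x) -> forall x, M' x -> M x).

Let hM : is_subfield M. Proof. by case: uM. Qed.

Lemma maximal_algebraic x : algebraic_over M x.
Proof.
have [P [P0 [LP rP]]] := halg x; exists P; split=> //; split=> // i.
by case: uM => _ h _; apply: h.
Qed.

(** The closure of [M] is a field with the values of [M], so by maximality it is [M]. *)
Lemma maximal_closed x : avclosure av qpow M x -> M x.
Proof.
apply: maxM x => [|x Mx]; last exact: (avclosure_base hav qpow_gt0).
split; first exact: (avclosure_subfield hav qpow1 qpow_gt0 qpow_scale).
  by move=> x Lx; apply: (avclosure_base hav qpow_gt0); case: uM => _ h _; apply: h.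
move=> x hx x0; have [y My xy] := avclosure_val hav qpow1 qpow_scale hx x0.
rewrite xy; case: uM => _ _; apply=> //.
by rewrite -(av_eq0 hav) -xy av_eq0.
Qed.

(** [P] lifts a monic polynomial over the residue field of [M] that kills the class of [u]; one of
    least size lifts the minimal polynomial of that class. *)
Let monic_small (u : E) (P : {poly E}) : Prop :=
  [/\ P \is monic, forall i, M P`_i, forall i, av P`_i <= 1 & av P.[u] < 1].

(** [A] is cut off after its last unit coefficient and divided by it. The discarded coefficients are
    below 1, so the value at [u] stays below 1. *)
Lemma monic_small_exists u (A : {poly E}) : av u <= 1 -> (forall i, M A`_i) ->
  (forall i, av A`_i <= 1) -> (exists i, av A`_i = 1) -> av A.[u] < 1 ->
  exists2 P, monic_small u P & (size P <= size A)%N.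
Proof.
move=> hu MA A1 [i0 Ai0] Au.
have bnd i : av A`_i == 1 -> (i <= size A)%N.
  move=> h; rewrite leqNgt; apply: contraTN h => h.
  by rewrite nth_default ?(ltnW h) // av0 // eq_sym oner_eq0.
have ex : exists i, av A`_i == 1 by exists i0; apply/eqP.
case: (ex_maxnP ex bnd) => k /eqP Ak kmax.
have Ak0 : A`_k != 0 by rewrite -(av_eq0 hav) Ak oner_eq0.
have kA : (k < size A)%N.
  by rewrite ltnNge; apply: contra Ak0 => h; rewrite nth_default.
case: (hM) => M0 M1 MB MM MV.
set T := take_poly k.+1 A; pose P := (A`_k)^-1 *: T.
have Tk : T`_k = A`_k by rewrite coef_take_poly ltnSn.
have sT : size T = k.+1.
  apply/eqP; rewrite eqn_leq size_take_poly /= ltnNge; apply: contra Ak0 => h.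
  by rewrite -Tk nth_default.
exists P; last by rewrite size_scale ?invr_eq0 // sT.
split.
- rewrite monicE lead_coefZ lead_coefE sT coef_take_poly ltnSn mulVf //.
- move=> i; rewrite coefZ; apply: (MM); first exact: (MV).
  by rewrite coef_take_poly; case: ifP.
- move=> i; rewrite coefZ avM // avV // Ak invr1 mul1r coef_take_poly.
  by case: ifP; rewrite ?av0.
rewrite hornerZ avM // avV // Ak invr1 mul1r.
have -> : T = A - drop_poly k.+1 A * 'X^(k.+1) by rewrite -[X in X - _](poly_take_drop k.+1) addrK.
rewrite hornerD hornerN hornerM hornerXn; apply: avB_lt => //.
apply: av_mul_lt1 => //; last by rewrite avX // exprn_ile1 ?av_ge0.
apply: av_horner_lt1 => // i; rewrite coef_drop_poly lt_neqAle A1 andbT.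
by apply/eqP => /eqP /kmax; rewrite addnS ltnNge leq_addl.
Qed.

(** Let [P] lift the minimal polynomial of the class of [u], and let [u'] be a root of [P] near [u].
    A shorter polynomial over [M], scaled to have largest coefficient 1, takes a unit value at [u'];
    so adjoining [u'] adds no values and [u'] lies in [M] by maximality. *)
Lemma maximal_residue u : av u <= 1 -> exists2 m, M m & av (u - m) < 1.
Proof.
move=> hu; case: (hM) => M0 M1 MB MM MV.
have scaled (A : {poly E}) : A != 0 -> (forall i, M A`_i) ->
    exists c, [/\ M c, c != 0, forall i, av (c *: A)`_i <= 1 & exists i, av (c *: A)`_i = 1].
  move=> A0 MA; have [m [Am hm]] := av_max_coef A0.
  exists (A`_m)^-1; split; [exact: (MV)|by rewrite invr_eq0| |].
    by move=> i; rewrite coefZ avM // avV // mulrC ler_pdivrMr ?av_gt0 // mul1r.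
  by exists m; rewrite coefZ mulVf // av1.
have ex : exists n, `[< exists2 P, monic_small u P & size P = n >].
  have [A [A0 [MA rA]]] := maximal_algebraic u.
  have [c [Mc c0 cA1 cA]] := scaled _ A0 MA.
  have McA i : M (c *: A)`_i by rewrite coefZ; apply: (MM).
  have Au : av (c *: A).[u] < 1 by rewrite hornerZ (rootP rA) mulr0 av0.
  have [P hP _] := monic_small_exists hu McA cA1 cA Au.
  by exists (size P); apply/asboolP; exists P.
case: (ex_minnP ex) => n /asboolP[P [monP MP P1 Pu] szP] nmin.
have [rs PE] := closed_field_poly_normal P.
rewrite (monicP monP) scale1r in PE.
(* [P.[u]] is the product of the differences of [u] with the roots, so one of these is below 1. *)
have [u' u'rs u'u] : exists2 z, z \in rs & av (u - z) < 1.
  have [//|no] := pselect (exists2 z, z \in rs & av (u - z) < 1).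
  have : 1 <= av P.[u]; last by rewrite leNgt Pu.
  rewrite PE horner_prod av_prod // big_seq; elim/big_ind: _ => // [a b ha hb|z zrs].
    exact: mulr_ege1.
  by rewrite hornerXsubC leNgt; apply/negP => h; apply: no; exists z.
have rP : root P u' by rewrite PE root_prod_XsubC.
have hu' : av u' <= 1.
  rewrite (_ : u' = u - (u - u')); last by ring.
  by apply: avB_le => //; apply: ltW.
suff uM' : unramified_over (adjoin M u').
  exists u' => //; apply: (maxM uM') (adjoin_gen hM _) => x; exact: adjoin_base.
split.
- exact/adjoin_subfield/maximal_algebraic.
- by move=> x Lx; apply: adjoin_base => //; case: uM => _ h _; apply: h.
move=> x /(adjoinP hM)[A ->] nz.
have [P1' PP] := poly_over_sf hM MP.
set i := @sfval _ _ hM in A nz PP *.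
pose B := map_poly i (A %% P1').
have BA : (map_poly i A).[u'] = B.[u'].
  rewrite {1}(divp_eq A P1') rmorphD rmorphM /= hornerD hornerM -PP (rootP rP) mulr0 add0r.
  by [].
have MBi j : M B`_j by rewrite coef_map; apply: sfvalP.
have P10 : P1' != 0.
  by apply: contraNneq (monic_neq0 monP) => P10; rewrite PP P10 rmorph0.
have szB : (size B < n)%N.
  by rewrite -szP PP !size_map_poly ltn_modp.
rewrite BA in nz *.
have B0 : B != 0 by apply: contraNneq nz => ->; rewrite horner0.
have [c [Mc c0 cB1 cB]] := scaled _ B0 MBi.
have le1 : av (c *: B).[u'] <= 1 by apply: av_horner_le1.
(* A value below 1 at [u'] is also below 1 at [u], which would give a lift shorter than [P]. *)
have nlt1 : ~ av (c *: B).[u'] < 1.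
  move=> h; have McB j : M (c *: B)`_j by rewrite coefZ; apply: (MM).
  have Bu : av (c *: B).[u] < 1.
    rewrite -(subrK (c *: B).[u'] (c *: B).[u]); apply: avD_lt => //.
    exact: av_horner_close.
  have [Q hQ szQ] := monic_small_exists hu McB cB1 cB Bu.
  have /nmin : `[< exists2 P, monic_small u P & size P = size Q >] by apply/asboolP; exists Q.
  rewrite leqNgt => /negP; apply; apply: leq_ltn_trans szQ _.
  by rewrite size_scale.
have e1 : av (c *: B).[u'] = 1.
  by apply/eqP; rewrite eq_le le1 leNgt; apply/negP.
have -> : av B.[u'] = av c^-1.
  have ac : av c != 0 by rewrite av_eq0.
  by apply: (mulfI ac); rewrite -!avM // -hornerZ e1 mulfV // av1.
by case: uM => _ _; apply; [apply: (MV)|rewrite invr_eq0].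
Qed.

End MaximalUnramified.
End Unramified.

(** * Automorphisms over a maximal extension are isometries *)

Section Isometry.
Variables (R : realFieldType) (E : closedFieldType) (av : E -> R) (p : nat).
Hypotheses (hav : nonarch_abs av) (hp : prime p) (hpadic : padic_on_nat av p).
Local Notation q := (p%:R : R).
Hypothesis htors : forall x, x != 0 -> exists2 k, (0 < k)%N & exists a : int, av x ^+ k = q ^ a.

Let q1 : 1 < q := p_gt1 R hp.
Let q0 : 0 < q := p_gt0 R hp.
Let qn0 : q != 0 := q_neq0 R hp.

Lemma common_torsion (ys : seq E) : exists2 h, (0 < h)%N &
  forall y, y \in ys -> y != 0 -> exists a : int, av y ^+ h = q ^ a.
Proof.
elim: ys => [|y ys [h h0 hh]]; first by exists 1%N.
have [k [k0 hk]] : exists k, (0 < k)%N /\ (y != 0 -> exists a : int, av y ^+ k = q ^ a).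
  have [->|y0] := eqVneq y 0; first by exists 1%N.
  by have [k k0 hk] := htors y0; exists k.
exists (h * k)%N; first by rewrite muln_gt0 h0.
move=> z; rewrite inE => /orP[/eqP ->|/hh hz] z0.
  have [a ea] := hk z0; exists (a * h%:Z).
  by rewrite mulnC exprM ea exprnP exprz_exp.
have [a ea] := hz z0; exists (a * k%:Z).
by rewrite exprM ea exprnP exprz_exp.
Qed.

Lemma av_p_exp (a : int) : av (p%:R ^ a) = q ^ (- a).
Proof.
case: a => n; first by rewrite -exprnP avX // av_p // -exprnN exprVn.
by rewrite NegzE -exprnN opprK avV // avX // av_p // exprVn invrK exprnP.
Qed.

Lemma q_exp_le (a b : int) : (q ^ a <= q ^ b) = (a <= b).
Proof. by rewrite !leNgt q_exp_lt. Qed.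

Section Near.
Variable e : R.
Hypotheses (e0 : 0 < e) (e1 : e < 1).

Definition near_one z := av (z - 1) <= e.

Lemma near_one_av z : near_one z -> av z = 1.
Proof.
move=> h; rewrite -[z](subrK 1) addrC av_dom ?av1 //; exact: le_lt_trans h _.
Qed.
Lemma near_one1 : near_one 1. Proof. by rewrite /near_one subrr av0 // ltW. Qed.
Lemma near_oneM y z : near_one y -> near_one z -> near_one (y * z).
Proof.
move=> hy hz; rewrite /near_one (_ : _ - _ = (y - 1) * z + (z - 1)); last by ring.
by apply: avD_le => //; rewrite avM // (near_one_av hz) mulr1.
Qed.
Lemma near_oneV z : near_one z -> near_one z^-1.
Proof.
move=> hz; have az := near_one_av hz.
have z0 : z != 0 by rewrite -(av_eq0 hav) az oner_eq0.
rewrite /near_one (_ : _ - _ = (1 - z) / z); last by field.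
by rewrite av_div // az divr1 avBC.
Qed.
Lemma near_one_add x : av x <= e -> near_one (1 + x).
Proof. by move=> h; rewrite /near_one addrC addKr. Qed.
End Near.

(* Multiplying out, the factor of a large [y] is close to [y] and that of a
   small [y] is close to [1], because [|u|] separates the powers [|y|^N]. *)
Lemma big_product_approx (ys : seq E) (x : E) (e : R) : x != 0 -> qpow p e ->
  exists N (a : int), let u := p%:R ^ a : E in
    (forall y, y \in ys -> y ^+ N + u != 0) /\
    av (\prod_(y <- ys) ((y ^+ N.+1 + u) / (y ^+ N + u)) -
        \prod_(y <- ys | av x <= av y) y) < e.
Proof.
move=> x0 he; set c := \prod_(y <- ys | _) y.
have [_ [k1 ->] ek1] := qpow_scale hav hp htors c he.
(* The precision [e1] is relative to the product [c]; one more power of [p] than required makes it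
   less than 1. *)
have [k kE] : exists k, k = k1.+1 by exists k1.+1.
set e1 : R := q ^- k.
have e10 : 0 < e1 by rewrite invr_gt0 exprn_gt0.
have e11 : e1 < 1 by rewrite invf_lt1 ?exprn_gt0 // exprn_egt1 // kE.
have ek : e1 * av c < e.
  apply: le_lt_trans ek1; rewrite ler_wpM2r ?av_ge0 // lef_pV2 ?posrE ?exprn_gt0 //.
  by rewrite kE ler_eXn2l // ltW.
have [b1 hb1] := av_bound hav hp htors x.
have [b2 hb2] := av_bound hav hp htors x^-1.
have [b bE] : exists b, b = (b1 + b2)%N by exists (b1 + b2)%N.
have hb : av x <= q ^+ b by apply: le_trans (ltW hb1) _; rewrite bE ler_eXn2l // leq_addr.
have ax0 : 0 < av x by rewrite av_gt0.
have hb' : q ^- b <= av x.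
  rewrite -[av x]invrK lef_pV2 ?posrE ?exprn_gt0 ?invr_gt0 // -avV //.
  by apply: le_trans (ltW hb2) _; rewrite bE ler_eXn2l // leq_addl.
have [h h0 hh] := common_torsion (x :: ys).
have [A xA] : exists a : int, av x ^+ h = q ^ a by apply: hh; rewrite ?mem_head.
(* The [N]-th powers of distinct nonzero values of [x :: ys] differ at least by the factor [q ^+ l].
   The value of [u] is put [k + b] powers of [q] below that of [x ^+ N], halfway to the next smaller
   one; [b] absorbs the extra factor in the exponent [N.+1]. *)
have [l lE] : exists l, l = (2 * k + 2 * b)%N by exists (2 * k + 2 * b)%N.
have [N NE] : exists N, N = (h * l)%N by exists (h * l)%N.
have [C CE] : exists C : int, C = A * l%:Z - k%:Z - b%:Z by exists (A * l%:Z - k%:Z - b%:Z).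
have xN : av x ^+ N = q ^ (A * l%:Z) by rewrite NE exprM xA exprnP exprz_exp.
set u := p%:R ^ (- C) : E.
have au : av u = q ^ C by rewrite av_p_exp opprK.
have e1E : e1 = q ^ (- k%:Z) by rewrite /e1 exprnN.
have uN : av u <= e1 * av x ^+ N.
  by rewrite au xN e1E -expfzDr // q_exp_le CE; clear; lia.
have uN1 : av u <= e1 * av x ^+ N.+1.
  rewrite exprS mulrCA; apply: (@le_trans _ _ (q ^- b * (e1 * av x ^+ N))).
    by rewrite au xN e1E exprnN -!expfzDr // q_exp_le CE; clear; lia.
  by rewrite ler_wpM2r // mulr_ge0 ?(ltW e10) // exprn_ge0 // ltW.
have small y : y \in ys -> av y < av x -> av y ^+ N <= e1 * av u /\ av y ^+ N.+1 <= e1 * av u.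
  move=> yys lt; have yN : av y ^+ N * q ^+ b <= e1 * av u.
    have [->|y0] := eqVneq y 0.
      rewrite av0 // expr0n.
      by rewrite gtn_eqF ?mul0r ?mulr_ge0 ?(ltW e10) ?av_ge0 // NE muln_gt0 h0 lE kE.
    have [B yB] : exists a : int, av y ^+ h = q ^ a by apply: hh; rewrite ?inE ?yys ?orbT.
    have BA : (B < A) by rewrite -(q_exp_lt R hp) -yB -xA ltrXn2r -?lt0n ?av_ge0.
    rewrite NE exprM yB exprnP exprz_exp au e1E [q ^+ b]exprnP -!expfzDr // q_exp_le CE.
    have : B * l%:Z <= (A - 1) * l%:Z by rewrite ler_wpM2r //; move: BA; clear; lia.
    by rewrite mulrBl mul1r; move: lE; clear; lia.
  have qb : 1 <= q ^+ b by rewrite exprn_ege1 // ltW.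
  have yN0 : 0 <= av y ^+ N by rewrite exprn_ge0 ?av_ge0.
  split; apply: le_trans yN; first by rewrite ler_peMr.
  by rewrite exprSr ler_wpM2l //; apply: ltW; apply: lt_le_trans lt hb.
have u0 : u != 0 by rewrite -(av_eq0 hav) au gt_eqF ?q_exp_gt0.
have au0 : 0 < av u by rewrite av_gt0.
have fbig y : av x <= av y -> near_one e1 ((y ^+ N.+1 + u) / (y ^+ N + u) / y) /\ y ^+ N + u != 0.
  move=> le; have y0 : y != 0 by rewrite -(av_gt0 hav); apply: lt_le_trans le.
  have nr n n' : av u <= e1 * av x ^+ n' -> n = n' -> near_one e1 (1 + u / y ^+ n).
    move=> hu ->; apply: near_one_add; rewrite av_div // avX // ler_pdivrMr ?exprn_gt0 ?av_gt0 //.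
    apply: le_trans hu _; rewrite ler_wpM2l ?(ltW e10) // lerXn2r ?nnegrE ?av_ge0 //.
  have n1 := nr _ _ uN1 erefl; have n2 := nr _ _ uN erefl.
  have nz : 1 + u / y ^+ N != 0 by rewrite -(av_eq0 hav) (near_one_av e11 n2) oner_eq0.
  have E2 : y ^+ N + u = y ^+ N * (1 + u / y ^+ N) by field; rewrite expf_neq0.
  have E1 : y ^+ N.+1 + u = y * y ^+ N * (1 + u / y ^+ N.+1).
    by rewrite exprS; field; rewrite y0 expf_neq0.
  have yN0 : y ^+ N != 0 by rewrite expf_neq0.
  split; last by rewrite E2 mulf_neq0.
  rewrite E1 E2 (_ : _ / _ = (1 + u / y ^+ N.+1) * (1 + u / y ^+ N)^-1); last first.
    move: nz; set w1 := 1 + _; set w2 := 1 + _ => nz; field.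
    by rewrite nz y0 yN0.
  exact: near_oneM e11 _ _ n1 (near_oneV e11 n2).
have fsmall y : y \in ys -> av y < av x ->
    near_one e1 ((y ^+ N.+1 + u) / (y ^+ N + u)) /\ y ^+ N + u != 0.
  move=> yys lt; have [s1 s2] := small y yys lt.
  have nr n n' : av y ^+ n' <= e1 * av u -> n = n' -> near_one e1 (1 + y ^+ n / u).
    by move=> hu ->; apply: near_one_add; rewrite av_div // avX // ler_pdivrMr.
  have n1 := nr _ _ s2 erefl; have n2 := nr _ _ s1 erefl.
  have nz : 1 + y ^+ N / u != 0 by rewrite -(av_eq0 hav) (near_one_av e11 n2) oner_eq0.
  have E2 : y ^+ N + u = u * (1 + y ^+ N / u) by field.
  have E1 : y ^+ N.+1 + u = u * (1 + y ^+ N.+1 / u) by field.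
  split; last by rewrite E2 mulf_neq0.
  rewrite E1 E2 (_ : _ / _ = (1 + y ^+ N.+1 / u) * (1 + y ^+ N / u)^-1); last first.
    by move: nz; set w1 := 1 + _; set w2 := 1 + _ => nz; field; rewrite nz u0.
  exact: near_oneM e11 _ _ n1 (near_oneV e11 n2).
exists N, (- C); rewrite -/u; split.
  by move=> y yys; have [/fbig[]|/(fsmall y yys)[]] := lerP (av x) (av y).
have c0 : c != 0.
  rewrite /c prodf_seq_neq0; apply/allP => y _; apply/implyP => le.
  by rewrite -(av_gt0 hav); apply: lt_le_trans le.
set pr := \prod_(y <- ys) _.
have : near_one e1 (pr / c).
  rewrite /pr /c (bigID (fun y => av x <= av y)) /= mulrAC -prodf_div.
  apply: near_oneM => //; rewrite big_seq_cond; elim/big_ind: _;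
    rewrite ?near_one1 //; try exact: near_oneM.
    by move=> y /andP[yys /fbig[]].
  by move=> y /andP[yys]; rewrite -ltNge => /(fsmall y yys)[].
rewrite /near_one => hpr; apply: le_lt_trans ek.
by rewrite -ler_pdivrMr ?av_gt0 // -av_div // mulrBl divff.
Qed.

Section Maximal.
Variables (L : E -> Prop) (hL : is_subfield L).
Hypothesis halg : forall x, algebraic_over L x.
Variable M : E -> Prop.
Hypotheses (uM : unramified_over av L M)
  (maxM : forall M', unramified_over av L M' -> (forall x, M x -> M' x) -> forall x, M' x -> M x).

Let hM : is_subfield M. Proof. by case: uM. Qed.
Let char0 : forall n, n.+1%:R != 0 :> E := padic_char0 hav hp hpadic.
Let algM : forall x, algebraic_over M x := maximal_algebraic halg uM.

Lemma Gal_stable_roots x : exists2 rs : seq E, uniq rs & x \in rs /\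
  forall s, in_Gal M s -> perm_eq (map s rs) rs.
Proof.
have [P [P0 [MP rP]]] := algM x; have [rs PE] := closed_field_poly_normal P.
have lc : lead_coef P != 0 by rewrite lead_coef_eq0.
have inrs z : (z \in undup rs) = root P z by rewrite mem_undup PE rootZ // root_prod_XsubC.
exists (undup rs); first exact: undup_uniq.
split; first by rewrite inrs.
move=> s [hs sM]; apply: uniq_perm; rewrite ?map_inj_uniq ?undup_uniq //; first exact: aut_inj.
apply: (uniq_min_size _ _ _).2; rewrite ?size_map ?leqnn ?map_inj_uniq ?undup_uniq //; first exact: aut_inj.
move=> _ /mapP[z + ->]; rewrite !inrs => /rootP rz; apply/rootP.
by rewrite -aut_horner // ?rz ?aut0 // => i; apply: sM.
Qed.

(* It is a limit of quotients that are symmetric in the roots. *)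
Lemma Gal_big_product x t (rs : seq E) : x != 0 -> M t -> av t < av x ->
  (forall s, in_Gal M s -> perm_eq (map s rs) rs) ->
  M (\prod_(y <- rs | av x <= av y) (t - y)).
Proof.
move=> x0 Mt tx hrs; apply: (maximal_closed hav hp htors uM maxM) => e he.
have [N [a /=]] := big_product_approx [seq t - y | y <- rs] x0 he.
set u := p%:R ^ a => -[nz]; rewrite !big_map => h.
exists (\prod_(y <- rs) (((t - y) ^+ N.+1 + u) / ((t - y) ^+ N + u))).
  apply: (fixed_by_Gal hM algM char0) => s sG; case: (sG) => hs sM.
  have su : s u = u by rewrite /u aut_exprz // aut_nat.
  rewrite aut_prod //; rewrite -[RHS](perm_big _ (hrs _ sG)) /= big_map.
  by apply: eq_bigr => y _; rewrite (aut_div hs) !(autD hs) !(autX hs) su (autB hs) sM.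
rewrite avBC //; move: h; congr (av (_ - _) < e); apply: eq_bigl => y.
have [h|h] := lerP (av x) (av y).
  by rewrite avBC // av_dom ?avN // ?h //; apply: lt_le_trans h.
by apply/negbTE; rewrite -ltNge; apply: avB_lt.
Qed.

(** Replaces the uniqueness of the extended absolute value over a complete field. The monic
    polynomial with the roots [y] in [rs] satisfying [av x <= av y] takes values in [M] at
    infinitely many points of [M], so [s] fixes it and [s x] is again one of its roots. The inverse
    of [s] gives the other inequality. *)
Lemma Gal_isometry s x : in_Gal M s -> av (s x) = av x.
Proof.
suff le z s' : in_Gal M s' -> av z <= av (s' z).
  move=> sG; apply/eqP; rewrite eq_le; apply/andP; split; last exact: le.
  case: (sG) => -[sD sM s1 sbij] sfix; case: (sbij) => s' ss' s's.
  have s'G : in_Gal M s'.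
    split; last by move=> y My; rewrite -[in LHS](sfix y My) ss'.
    split.
    - by move=> a b; apply: (can_inj ss'); rewrite sD !s's.
    - by move=> a b; apply: (can_inj ss'); rewrite sM !s's.
    - by apply: (can_inj ss'); rewrite s1 s's.
    - by exists s.
  by have := le (s x) s' s'G; rewrite ss'.
clear s x; move=> sG; rename z into x; rename s' into s.
have [->|x0] := eqVneq x 0; first by rewrite av0 // av_ge0.
have [rs urs [xrs hrs]] := Gal_stable_roots x.
case: (sG) => hs sM.
pose bs := [seq y <- rs | av x <= av y].
pose B := \prod_(y <- bs) ('X - y%:P); pose B' := \prod_(y <- map s bs) ('X - y%:P).
have [n hn] := av_bound hav hp htors x^-1.
(* Distinct points of [M] smaller than [x], to which [Gal_big_product] applies. *)
pose t j := (p ^ (n + j))%:R : E.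
have Mt j : M (t j) by apply: (subfield_nat hM).
have tx j : av (t j) < av x.
  have h : av x^-1 < q ^+ (n + j).
    by apply: lt_le_trans hn _; rewrite exprD ler_peMr ?exprn_ege1 // ltW // exprn_gt0.
  rewrite avV // in h; rewrite /t natrX avX // av_p // exprVn.
  by rewrite invf_plt ?posrE ?exprn_gt0 ?(av_gt0 hav).
have BB' : B = B'.
  apply/eqP; rewrite -subr_eq0; apply/eqP.
  apply: (@roots_geq_poly_eq0 _ _ (mkseq t (size (B - B')))); last by rewrite size_mkseq.
    apply/allP => _ /mapP[j _ ->]; rewrite /root hornerD hornerN subr_eq0; apply/eqP.
    rewrite !horner_prod !big_map !big_filter.
    under eq_bigr => y _ do rewrite hornerXsubC.
    under [RHS]eq_bigr => y _ do rewrite hornerXsubC.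
    have := Gal_big_product x0 (Mt j) (tx j) hrs => /sM <-.
    by rewrite aut_prod //; apply: eq_bigr => y _; rewrite autB // sM.
  rewrite map_inj_uniq ?iota_uniq // => i j /(congr1 av).
  rewrite /t !natrX !avX // av_p // => e.
  have : q ^ (n + i)%:Z = q ^ (n + j)%:Z.
    by rewrite -!exprnP; apply: invr_inj; rewrite -!exprVn.
  by move/(q_exp_inj hp); lia.
have : root B (s x).
  rewrite BB' root_prod_XsubC; apply: map_f.
  by rewrite mem_filter lexx xrs.
by rewrite root_prod_XsubC mem_filter => /andP[].
Qed.

(** An integral [x] is congruent to some [m] in [M], which [s] fixes, and the isometry [s] keeps
    [x - m] below 1. *)
Lemma Gal_inertia s : in_Gal M s -> in_inertia av L s.
Proof.
move=> sG; case: (sG) => hs sM; split.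
  by split=> // x Lx; apply: sM; case: uM => _ h _; apply: h.
move=> x hx; have [m Mm hm] := maximal_residue hav halg uM maxM hx.
rewrite (_ : s x - x = s (x - m) - (x - m)); last by rewrite autB // (sM m) //; ring.
by apply: avB_lt => //; rewrite Gal_isometry.
Qed.
End Maximal.

Lemma inertia_fixed_value (L : E -> Prop) (hL : is_subfield L)
  (halg : forall x, algebraic_over L x) (x : E) :
  x != 0 -> (forall s, in_inertia av L s -> s x = x) ->
  exists2 l, L l & av x = av l.
Proof.
move=> x0 fx; have [M [uM maxM]] := maximal_unramified av hL.
case: (uM) => hM _ valM; apply: valM => //.
apply: (fixed_by_Gal hM (maximal_algebraic halg uM) (padic_char0 hav hp hpadic)) => s sG.
exact/fx/(Gal_inertia halg uM maxM).
Qed.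

End Isometry.
(** * Integral polynomials *)

Section IntegralAlgebra.
Variables (R : realFieldType) (E : closedFieldType) (av : E -> R).
Hypothesis hav : nonarch_abs av.

Lemma av_prod_le1 (I : Type) (r : seq I) (P : pred I) (F : I -> E) :
  (forall i, P i -> av (F i) <= 1) -> av (\prod_(i <- r | P i) F i) <= 1.
Proof. by move=> h; elim/big_ind: _ => //; [rewrite av1|exact: av_mul_le1]. Qed.

Lemma av_sign n : av ((-1) ^+ n) = 1.
Proof. by rewrite avX // avN // av1 // expr1n. Qed.

Lemma av_det n (A : 'M[E]_n) : (forall i j, av (A i j) <= 1) -> av (\det A) <= 1.
Proof.
move=> hA; apply: av_sum_le => // s _; apply: av_mul_le1 => //; first by rewrite av_sign.
exact: av_prod_le1.
Qed.

(** The adjugate of [A] is integral and recovers [v] up to the unit [\det A]. *)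
Lemma small_mulmx n (A : 'M[E]_n) (v : 'cV[E]_n) : (forall i j, av (A i j) <= 1) ->
  av (\det A) = 1 -> (forall i, av ((A *m v) i 0) < 1) -> forall j, av (v j 0) < 1.
Proof.
move=> hA dA hAv j.
have := congr1 (fun B : 'M[E]_n => (B *m v) j 0) (mul_adj_mx A).
rewrite mul_scalar_mx [RHS]mxE -mulmxA => /(congr1 av); rewrite [in RHS]avM // dA mul1r => <-.
rewrite mxE; apply: av_sum_lt => // i _; rewrite mulrC; apply: av_mul_lt1 => //.
rewrite mxE; apply: av_mul_le1 => //; first by rewrite av_sign.
by apply: av_det => k l; rewrite !mxE.
Qed.

(** If every root were at distance at least 1 from [x], multiplying out the linear factors would
    bound each coefficient of [h] by [av h.[x]]. As [E] is algebraically closed, the reduction may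
    have a multiple root, unlike in Hensel's lemma. *)
Lemma near_root (h : {poly E}) x : (exists i, 1 <= av h`_i) -> av x <= 1 ->
  av h.[x] < 1 -> exists2 x', root h x' & av (x - x') < 1.
Proof.
move=> [i0 hi0] hx hhx; have [rs hE] := closed_field_poly_normal h.
have h0 : lead_coef h != 0.
  by rewrite lead_coef_eq0; apply: contraTneq hi0 => ->; rewrite coef0 av0 // ler10.
have [[r rrs rx]|no] := pselect (exists2 r, r \in rs & av (x - r) < 1).
  by exists r => //; rewrite hE rootZ // root_prod_XsubC.
have far r : r \in rs -> 1 <= av (x - r).
  by move=> rrs; rewrite leNgt; apply/negP => rx; apply: no; exists r.
exfalso; have coef i : av h`_i <= av h.[x].
  rewrite hE coefZ hornerZ !avM // ler_wpM2l ?av_ge0 //; move: far; clear -hav hx.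
  elim: rs i => [|r rs IH] i far.
    by rewrite !big_nil hornerC coefC; case: eqP; rewrite ?av1 ?av0.
  have far' z : z \in rs -> 1 <= av (x - z) by move=> zrs; rewrite far // inE zrs orbT.
  have fr : 1 <= av (x - r) by rewrite far // mem_head.
  have rr : av r <= av (x - r).
    rewrite {1}(_ : r = x - (x - r)); last by ring.
    by apply: avB_le => //; apply: le_trans hx fr.
  rewrite !big_cons hornerM hornerXsubC avM // mulrBl coefB coefXM coefCM.
  apply: avB_le => //.
    case: eqP => _; first by rewrite av0 // mulr_ge0 ?av_ge0.
    by apply: le_trans (IH _ far') _; rewrite ler_peMl ?av_ge0.
  by rewrite avM // ler_pM ?av_ge0 // IH.
by have := le_lt_trans (le_trans hi0 (coef i0)) hhx; rewrite ltxx.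
Qed.

Definition eqm (x y : E) := av (x - y) < 1.

Lemma eqm_refl x : eqm x x. Proof. by rewrite /eqm subrr av0. Qed.
Lemma eqmD x y x' y' : eqm x x' -> eqm y y' -> eqm (x + y) (x' + y').
Proof.
move=> h h'; rewrite /eqm (_ : _ - _ = (x - x') + (y - y')); last by ring.
exact: avD_lt.
Qed.
Lemma eqmB x y x' y' : eqm x x' -> eqm y y' -> eqm (x - y) (x' - y').
Proof.
move=> h h'; rewrite /eqm (_ : _ - _ = (x - x') - (y - y')); last by ring.
exact: avB_lt.
Qed.
Lemma eqmM x y x' y' : av x <= 1 -> av y' <= 1 -> eqm x x' -> eqm y y' -> eqm (x * y) (x' * y').
Proof.
move=> hx hy h h'; rewrite /eqm (_ : _ - _ = (y - y') * x + (x - x') * y'); last by ring.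
by apply: avD_lt => //; apply: av_mul_lt1.
Qed.
Lemma av_exp_le1 x n : av x <= 1 -> av (x ^+ n) <= 1.
Proof. by move=> h; rewrite avX // exprn_ile1 ?av_ge0. Qed.
Lemma eqmX x x' n : av x <= 1 -> av x' <= 1 -> eqm x x' -> eqm (x ^+ n) (x' ^+ n).
Proof.
move=> hx hx' h; elim: n => [|n IH]; first exact: eqm_refl.
by rewrite !exprS; apply: eqmM => //; apply: av_exp_le1.
Qed.
Lemma eqm_sum (I : Type) (r : seq I) (F G : I -> E) : (forall i, eqm (F i) (G i)) ->
  eqm (\sum_(i <- r) F i) (\sum_(i <- r) G i).
Proof. by move=> h; elim/big_ind2: _ => //; [exact: eqm_refl|move=> *; exact: eqmD]. Qed.

Definition integral_poly (P : {poly E}) := forall i, av P`_i <= 1.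

(** The divided difference of [P], written as a sum so that it makes sense on the diagonal, where it
    is the derivative. *)
Definition diffquot (P : {poly E}) x y :=
  \sum_(i < size P) P`_i * \sum_(k < i) x ^+ (i.-1 - k) * y ^+ k.

Lemma diffquotE P x y : P.[x] - P.[y] = (x - y) * diffquot P x y.
Proof.
rewrite !horner_coef -sumrB mulr_sumr; apply: eq_bigr => i _.
by rewrite -mulrBr subrXX mulrCA.
Qed.

Lemma diffquot_diag P x : diffquot P x x = P^`().[x].
Proof.
rewrite /diffquot; have -> : P^`() = \sum_(i < size P) P`_i *: ('X^i)^`().
  rewrite -[in LHS](coefK P) poly_def raddf_sum; apply: eq_bigr => i _.
  by rewrite -[LHS]/((P`_i *: 'X^i)^`()) derivZ.
rewrite horner_sum; apply: eq_bigr => i _; rewrite hornerZ; congr (_ * _).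
rewrite derivXn hornerMn hornerXn; under eq_bigr => k _.
  rewrite -exprD subnK; last by rewrite -ltnS prednK ?ltn_ord // (leq_trans _ (ltn_ord k)).
  over.
by rewrite sumr_const card_ord.
Qed.

Section DiffQuot.
Variable P : {poly E}.
Hypothesis hP : integral_poly P.
Lemma av_poly_le1 x : av x <= 1 -> av P.[x] <= 1.
Proof. by move=> hx; apply: av_horner_le1. Qed.
Lemma eqm_poly x x' : av x <= 1 -> av x' <= 1 -> eqm x x' -> eqm P.[x] P.[x'].
Proof. by move=> hx hx' h; apply: av_horner_close. Qed.
Lemma av_diffquot x y : av x <= 1 -> av y <= 1 -> av (diffquot P x y) <= 1.
Proof.
move=> hx hy; apply: av_sum_le => // i _; apply: av_mul_le1 => //.
by apply: av_sum_le => // k _; apply: av_mul_le1 => //; apply: av_exp_le1.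
Qed.
Lemma eqm_diffquot x x' y y' : av x <= 1 -> av x' <= 1 -> av y <= 1 -> av y' <= 1 ->
  eqm x x' -> eqm y y' -> eqm (diffquot P x y) (diffquot P x' y').
Proof.
move=> hx hx' hy hy' xx' yy'; apply: eqm_sum => i; apply: eqmM => //; last 2 first.
- exact: eqm_refl.
- by apply: eqm_sum => k; apply: eqmM; rewrite ?av_exp_le1 //; apply: eqmX.
by apply: av_sum_le => // k _; apply: av_mul_le1 => //; apply: av_exp_le1.
Qed.
End DiffQuot.

(* [wdq A B x y] is [(A(x) B(y) - A(y) B(x)) / (x - y)]; on the diagonal it is
   the Wronskian. *)
Definition wdq (A B : {poly E}) x y := diffquot A x y * B.[y] - A.[y] * diffquot B x y.

Lemma wdqE A B x y : A.[x] * B.[y] - A.[y] * B.[x] = (x - y) * wdq A B x y.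
Proof.
have hA := diffquotE A x y; have hB := diffquotE B x y.
by rewrite /wdq mulrBr mulrA -hA mulrCA -hB; ring.
Qed.

Lemma wdq_diag A B x : wdq A B x x = (A^`() * B - A * B^`()).[x].
Proof. by rewrite /wdq !diffquot_diag hornerD hornerN !hornerM. Qed.

Lemma av_wdq A B x y : integral_poly A -> integral_poly B -> av x <= 1 -> av y <= 1 ->
  av (wdq A B x y) <= 1.
Proof.
move=> hA hB hx hy; apply: avB_le => //; apply: av_mul_le1 => //;
  by [apply: av_diffquot|apply: av_poly_le1].
Qed.

Lemma eqm_wdq A B x x' y y' : integral_poly A -> integral_poly B ->
  av x <= 1 -> av x' <= 1 -> av y <= 1 -> av y' <= 1 ->
  eqm x x' -> eqm y y' -> eqm (wdq A B x y) (wdq A B x' y').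
Proof.
move=> hA hB hx hx' hy hy' xx' yy'; apply: eqmB; apply: eqmM;
  by [apply: av_diffquot|apply: av_poly_le1|apply: eqm_diffquot|apply: eqm_poly].
Qed.

End IntegralAlgebra.

(** * A unit coefficient of the Wronskian *)

Section Wronskian.
Variables (R : realFieldType) (E : closedFieldType) (av : E -> R) (p : nat).
Hypotheses (hav : nonarch_abs av) (hp : prime p) (hpadic : padic_on_nat av p).

(** Modulo the maximal ideal [h] begins in degree [e], so this coefficient reduces to [e] times the
    product of two units; [e] is a unit because [e < p]. *)
Lemma wronskian_unit_coef (h B : {poly E}) e : integral_poly av h -> integral_poly av B ->
  (0 < e < p)%N -> av h`_e = 1 -> (forall i, (i < e)%N -> av h`_i < 1) -> av B`_0 = 1 ->
  av (h^`() * B - h * B^`())`_e.-1 = 1.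
Proof.
move=> hh hB /andP[e0 ep] he hlt hB0.
have hMn (P : {poly E}) i n : integral_poly av P -> av (P`_i *+ n) <= 1.
  by move=> hP; rewrite -mulr_natr; apply: av_mul_le1 => //; apply: av_nat.
rewrite coefB coefM; have {}e0 := prednK e0; move: (e.-1) e0 => n ne.
rewrite big_ord_recr /= subnn coef_deriv ne addrAC addrC.
have main : av (h`_e *+ e * B`_0) = 1.
  by rewrite avM // hB0 mulr1 -mulr_natr avM // he mul1r (av_small_nat hp hpadic) // ep -ne.
rewrite av_dom // main; apply: avB_lt => //.
  apply: av_sum_lt => // i _; apply: av_mul_lt1 => //.
  rewrite coef_deriv -mulr_natr; apply: av_mul_lt1 => //; last exact: av_nat.
  by apply: hlt; rewrite -ne ltnS.
rewrite coefM; apply: av_sum_lt => // i _; apply: av_mul_lt1 => //.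
  by apply: hlt; rewrite -ne.
by rewrite coef_deriv; apply: hMn.
Qed.
End Wronskian.
(** * Reduction of rational maps *)

Section Charts.
Variables (R : realFieldType) (E : closedFieldType) (av : E -> R).
Hypothesis hav : nonarch_abs av.

(** P^1 is split into the closed unit disc with coordinate [x] and its complement with coordinate
    [x^-1]. The complement is one residue class, that of infinity. *)
Definition chart (z : option E) : bool := if z is Some x then av x <= 1 else false.
Definition coord (z : option E) : E :=
  if z is Some x then (if av x <= 1 then x else x^-1) else 0.
Definition point (b : bool) (x : E) : option E :=
  if b then Some x else if x == 0 then None else Some x^-1.
Definition sim (z w : option E) : bool :=
  (chart z == chart w) && (av (coord z - coord w) < 1).
(* The point of homogeneous coordinates [X : Y]. *)
Definition proj (X Y : E) : option E := if Y != 0 then Some (X / Y) else None.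
Definition normalised (X Y : E) : Prop :=
  [/\ av X <= 1, av Y <= 1 & ~ (av X < 1 /\ av Y < 1)].

Lemma av_coord z : av (coord z) <= 1.
Proof.
case: z => [x|] /=; last by rewrite av0 // ler01.
case: ifP => // /negbT; rewrite -ltNge => h; rewrite avV // invf_le1 ?ltW //.
by rewrite (lt_trans _ h).
Qed.
Lemma av_coord_lt z : ~~ chart z -> av (coord z) < 1.
Proof.
case: z => [x|] /=; last by rewrite av0 // ltr01.
move=> h; rewrite (negbTE h); move: h; rewrite -ltNge => h; rewrite avV // invf_lt1 //.
by rewrite (lt_trans _ h).
Qed.
Lemma chartK z : point (chart z) (coord z) = z.
Proof.
case: z => [x|] /=; rewrite /point; last by rewrite eqxx.
case: (lerP (av x) 1) => // h; rewrite invr_eq0 invrK ifF //.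
by apply: contraTF h => /eqP ->; rewrite av0 // ltr10.
Qed.
Lemma coord_inj z w : chart z = chart w -> coord z = coord w -> z = w.
Proof. by move=> h h'; rewrite -(chartK z) -(chartK w) h h'. Qed.
Lemma chart_point b x : (if b then av x <= 1 else av x < 1) ->
  chart (point b x) = b /\ coord (point b x) = x.
Proof.
case: b => /=; first by rewrite /chart /coord => ->.
rewrite /point; case: eqP => [-> _|/eqP x0 h] //=.
rewrite avV // invf_le1 ?av_gt0 // leNgt h /= invrK.
by [].
Qed.

Lemma simxx z : sim z z. Proof. by rewrite /sim eqxx subrr av0 // ltr01. Qed.
Lemma sim_sym z w : sim z w = sim w z.
Proof. by rewrite /sim eq_sym avBC. Qed.
Lemma sim_trans z w u : sim z w -> sim w u -> sim z u.
Proof.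
rewrite /sim => /andP[/eqP -> h] /andP[/eqP -> h']; rewrite eqxx /=.
rewrite (_ : _ - _ = (coord z - coord w) + (coord w - coord u)); last by ring.
exact: avD_lt.
Qed.
Lemma sim_infty z : ~~ chart z -> sim None z.
Proof.
move=> h; rewrite /sim /= (negbTE h) eqxx /= sub0r avN //; exact: av_coord_lt.
Qed.

Lemma proj_chart X Y : normalised X Y ->
  chart (proj X Y) = (av Y == 1) /\ coord (proj X Y) = if av Y == 1 then X / Y else Y / X.
Proof.
case=> hX hY hXY; rewrite /proj; have [Y0|Y0] := eqVneq Y 0.
  by rewrite /= Y0 av0 // eq_sym oner_eq0 mul0r.
have aY : 0 < av Y by rewrite av_gt0.
rewrite /chart /coord /= av_div // ler_pdivrMr // mul1r.
have [Y1|Y1] := eqVneq (av Y) 1; first by rewrite Y1 hX.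
have ltY : av Y < 1 by rewrite lt_neqAle Y1.
have X1 : av X = 1 by apply/eqP; rewrite eq_le hX leNgt; apply/negP => h; apply: hXY.
by rewrite X1 leNgt ltY /= invf_div.
Qed.

Lemma normalised_unit X Y : normalised X Y -> av Y != 1 -> av X = 1 /\ av Y < 1.
Proof.
case=> hX hY hXY Y1; have ltY : av Y < 1 by rewrite lt_neqAle Y1.
split=> //; apply/eqP; rewrite eq_le hX leNgt; apply/negP => h; exact: hXY.
Qed.

(** In normalised coordinates [av (X * Y' - X' * Y)] is the chordal distance: 1 between the two
    charts, and the distance of the coordinates inside one. *)
Lemma proj_sim X Y X' Y' : normalised X Y -> normalised X' Y' ->
  sim (proj X Y) (proj X' Y') = (av (X * Y' - X' * Y) < 1) /\
  (av Y == 1 = (av Y' == 1) ->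
   av (coord (proj X Y) - coord (proj X' Y')) = av (X * Y' - X' * Y)).
Proof.
move=> n n'; rewrite /sim; have [-> ->] := proj_chart n; have [-> ->] := proj_chart n'.
have nz Z : av Z = 1 -> Z != 0 by move=> h; rewrite -(av_eq0 hav) h oner_eq0.
have [Y1|Y1] := eqVneq (av Y) 1; have [Y1'|Y1'] := eqVneq (av Y') 1; rewrite ?eqxx /=.
- have e : av (X / Y - X' / Y') = av (X * Y' - X' * Y).
    rewrite (_ : _ - _ = (X * Y' - X' * Y) / (Y * Y')); last by field; rewrite !nz.
    by rewrite av_div // avM // Y1 Y1' mulr1 divr1.
  by rewrite e.
- have [X1' ltY'] := normalised_unit n' Y1'; split=> //; apply/esym/negbTE.
  rewrite -leNgt avBC // av_dom ?avM ?avN // ?X1' ?Y1 ?mulr1 //.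
  by rewrite avM // mulrC; case: n => hX *; apply: le_lt_trans ltY'; rewrite ler_piMr ?av_ge0.
- have [X1 ltY] := normalised_unit n Y1; split=> //; apply/esym/negbTE.
  rewrite -leNgt av_dom ?avM ?avN // ?X1 ?Y1' ?mulr1 //.
  by rewrite avM // mulrC; case: n' => hX' *; apply: le_lt_trans ltY; rewrite ler_piMr ?av_ge0.
have [X1 ltY] := normalised_unit n Y1; have [X1' ltY'] := normalised_unit n' Y1'.
have e : av (Y / X - Y' / X') = av (X * Y' - X' * Y).
  rewrite (_ : _ - _ = (X' * Y - X * Y') / (X * X')); last by field; rewrite !nz.
  by rewrite av_div // avM // X1 X1' mulr1 divr1 avBC.
by rewrite e.
Qed.

Lemma proj_eq X Y X' Y' : normalised X Y -> normalised X' Y' ->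
  X * Y' = X' * Y -> proj X Y = proj X' Y'.
Proof.
move=> n n' e; have [s d] := proj_sim n n'.
rewrite e subrr av0 // ltr01 in s d; have /andP[/eqP c _] : sim (proj X Y) (proj X' Y') by rewrite s.
apply: (coord_inj c); apply/eqP; rewrite -subr_eq0 -(av_eq0 hav) d //.
by have [<- _] := proj_chart n; have [<- _] := proj_chart n'.
Qed.

Definition hcoord (z : option E) : E * E :=
  if chart z then (coord z, 1) else (1, coord z).

Lemma hcoord_norm z : normalised (hcoord z).1 (hcoord z).2.
Proof.
rewrite /hcoord; have c := av_coord z.
by case: ifP => _; split; rewrite ?av1 //=; case; rewrite ?av1 // ltxx.
Qed.
Lemma hcoordK z : proj (hcoord z).1 (hcoord z).2 = z.
Proof.
rewrite /hcoord /proj -[RHS](chartK z); case: (chart z) => /=.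
  by rewrite oner_eq0 divr1.
by case: eqP => //= _; rewrite mul1r.
Qed.

End Charts.

(** * Maps with good reduction: lifting, contraction and critical classes *)

Section GoodReduction.
Variables (R : realFieldType) (E : closedFieldType) (av : E -> R).
Hypothesis hav : nonarch_abs av.
Variables (d : nat) (F G : {poly E}).
Hypotheses (d0 : (0 < d)%N) (hF : integral_poly av F) (hG : integral_poly av G).
Hypotheses (hFsz : (size F <= d.+1)%N) (hGsz : (size G <= d.+1)%N).
Hypothesis hgood : av (hres d F G) = 1.

Local Notation f := (ratmap d F G).
Local Notation chart := (chart av).
Local Notation coord := (coord av).
Local Notation sim := (sim av).
Local Notation normalised := (normalised av).

(** [P] in the chart at infinity. The reversal is relative to [d], not to the size of [P], so that
    [F] and [G] are multiplied by the same power. *)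
Definition revp (P : {poly E}) : {poly E} := \poly_(i < d.+1) P`_(d - i).
Definition inchart (b : bool) (P : {poly E}) : {poly E} := if b then P else revp P.

Lemma inchart_integral b P : integral_poly av P -> integral_poly av (inchart b P).
Proof.
by case: b => //= hP i; rewrite coef_poly; case: ifP => _; rewrite ?av0 ?ler01.
Qed.
Lemma size_inchart b (P : {poly E}) : (size P <= d.+1)%N -> (size (inchart b P) <= d.+1)%N.
Proof. by case: b => //= _; apply: size_poly. Qed.
Lemma revp_horner (P : {poly E}) x : (size P <= d.+1)%N -> x != 0 -> (revp P).[x] = x ^+ d * P.[x^-1].
Proof.
move=> hP x0; rewrite horner_poly (horner_coef_wide _ hP) mulr_sumr (reindex_inj rev_ord_inj) /=.
apply: eq_bigr => i _; have id : (i <= d)%N by rewrite -ltnS.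
rewrite subSS subKn // mulrCA; congr (_ * _).
by rewrite exprVn expfB_cond // (negbTE x0) add0n.
Qed.

Lemma f_inchart z : f z = proj (inchart (chart z) F).[coord z] (inchart (chart z) G).[coord z].
Proof.
case: z => [x|] /=; last by rewrite /proj !horner_coef0 !coef_poly /= subn0.
case: (lerP (av x) 1) => //= h; have x0 : x != 0.
  by apply: contraTneq h => ->; rewrite av0 // ltr10.
rewrite /proj !revp_horner ?invr_eq0 // invrK.
have y0 : x^-1 ^+ d != 0 by rewrite expf_neq0 // invr_eq0.
by rewrite mulf_eq0 (negbTE y0) /=; case: eqP => //= _; rewrite -mulf_div divff // mul1r.
Qed.

Definition hom (P : {poly E}) u v := \sum_(k < d.+1) P`_(d - k) * (u ^+ (d - k) * v ^+ k).

Lemma inchart_hom b (P : {poly E}) x : (size P <= d.+1)%N ->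
  (inchart b P).[x] = if b then hom P x 1 else hom P 1 x.
Proof.
move=> hP; case: b => /=; last first.
  by rewrite horner_poly; apply: eq_bigr => k _; rewrite expr1n mul1r.
rewrite (horner_coef_wide _ hP) (reindex_inj rev_ord_inj) /=.
by apply: eq_bigr => k _; rewrite subSS expr1n mulr1.
Qed.

Let Syl : 'M[E]_(d + d) := \matrix_(i < d + d, j < d + d)
  (let H := if (i < d)%N then F else G in
   let i' := if (i < d)%N then (i : nat) else (i - d)%N in
   if (i' <= j)%N && (j <= i' + d)%N then H`_(d - (j - i')) else 0).

Lemma Syl_integral i j : av (Syl i j) <= 1.
Proof.
rewrite mxE /=; case: (i < d)%N; case: ifP => _; rewrite ?av0 ?ler01 //;
  by [apply: hF|apply: hG].
Qed.

(** A Sylvester row applied to the monomials of degree [2d - 1] gives a monomial times the form;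
    only the window from [i'] to [i' + d] contributes. *)
Lemma Syl_shift (P : {poly E}) (i' : nat) u v : (i' < d)%N ->
  \sum_(j < d + d) (if (i' <= j)%N && (j <= i' + d)%N then P`_(d - (j - i')) else 0) *
     (u ^+ ((d + d).-1 - j) * v ^+ j) = u ^+ (d.-1 - i') * v ^+ i' * hom P u v.
Proof.
move=> hi; pose g j := (if (i' <= j)%N && (j <= i' + d)%N then P`_(d - (j - i')) else 0) *
     (u ^+ ((d + d).-1 - j) * v ^+ j).
rewrite -(big_mkord xpredT g) (@big_cat_nat _ _ _ i') //=; last by lia.
rewrite (@big_cat_nat _ _ _ (i' + d).+1 i') //=; [|lia|lia].
rewrite big_nat big1 ?add0r; last first.
  by move=> j /andP[_ hj]; rewrite /g leqNgt hj /= mul0r.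
rewrite [X in _ + X]big_nat [X in _ + X]big1 ?addr0; last first.
  by move=> j /andP[hj _]; rewrite /g [(j <= _)%N]leqNgt hj andbF mul0r.
have -> : ((i' + d).+1 = d.+1 + i')%N by rewrite addSn addnC.
rewrite -{1}[i']add0n big_addn addnK big_mkord mulr_sumr.
apply: eq_bigr => k _; rewrite /g leq_addl addnC leq_add2l -ltnS ltn_ord /= addKn.
rewrite (_ : (d + d).-1 - (i' + k) = (d.-1 - i') + (d - k))%N; last first.
  by have := ltn_ord k; lia.
rewrite !exprD; ring.
Qed.

(** The two forms have no common zero in the residue field. If both are small, so is the Sylvester
    matrix applied to the monomials; its determinant is a unit, so the monomials are small, in
    particular the pure powers of [u] and [v]. *)
Lemma hom_small u v : av u <= 1 -> av v <= 1 -> av (hom F u v) < 1 -> av (hom G u v) < 1 ->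
  av u < 1 /\ av v < 1.
Proof.
move=> hu hv hFs hGs.
pose w : 'cV[E]_(d + d) := \col_j (u ^+ ((d + d).-1 - j) * v ^+ j).
have Sw i : av ((Syl *m w) i 0) < 1.
  rewrite mxE; under eq_bigr => j _ do rewrite !mxE.
  pose H := if (i < d)%N then F else G.
  pose i' := if (i < d)%N then (i : nat) else (i - d)%N.
  have hi' : (i' < d)%N by rewrite /i'; case: (ltnP i d) => // h; rewrite ltn_subLR.
  rewrite -/H -/i' (Syl_shift H) // mulrC; apply: av_mul_lt1 => //.
    by rewrite /H; case: ifP.
  by apply: av_mul_le1 => //; apply: av_exp_le1.
have wS := small_mulmx hav Syl_integral hgood Sw.
have root n (x : E) : av (x ^+ n) < 1 -> av x < 1.
  rewrite avX // => h; rewrite ltNge; apply/negP => h1.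
  by move: h; rewrite ltNge exprn_ege1.
have l0 : (0 < d + d)%N by rewrite addn_gt0 d0.
have l1 : ((d + d).-1 < d + d)%N by rewrite prednK.
split.
  by have := wS (Ordinal l0); rewrite mxE /= subn0 expr0 mulr1; apply: root.
by have := wS (Ordinal l1); rewrite mxE /= subnn expr0 mul1r; apply: root.
Qed.

Lemma inchart_normalised b x : av x <= 1 ->
  normalised (inchart b F).[x] (inchart b G).[x].
Proof.
move=> hx; split; try by apply: av_poly_le1 => //; apply: inchart_integral.
have h1 : av 1 <= 1 by rewrite av1.
rewrite !inchart_hom //; case: b => -[h h'].
  by have [_] := hom_small hx h1 h h'; rewrite av1 // ltxx.
by have [] := hom_small h1 hx h h'; rewrite av1 // ltxx.
Qed.

(** The coefficients of [a2 F - a1 G] combine the first [F]-row and the first [G]-row of the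
    Sylvester matrix, and its rows are independent modulo the maximal ideal. *)
Lemma pencil_unit_coef a1 a2 : normalised a1 a2 -> exists i, 1 <= av (a2 *: F - a1 *: G)`_i.
Proof.
case=> h1 h2 h12; have [//|no] := pselect (exists i, 1 <= av (a2 *: F - a1 *: G)`_i).
have lt1 i : av (a2 *: F - a1 *: G)`_i < 1.
  by rewrite ltNge; apply/negP => h; apply: no; exists i.
exfalso.
have l0 : (0 < d + d)%N by rewrite addn_gt0 d0.
have l1 : (d < d + d)%N by rewrite -{1}[d]addn0 ltn_add2l.
pose i0 := Ordinal l0; pose i1 := Ordinal l1.
pose v : 'cV[E]_(d + d) := \col_i (if i == i0 then a2 else if i == i1 then - a1 else 0).
have i10 : i1 != i0 by rewrite -val_eqE /= -lt0n.
have Sv j : av ((Syl^T *m v) j 0) < 1.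
  rewrite mxE (bigD1 i0) //= (bigD1 i1) ?i10 //= big1 ?addr0; last first.
    by move=> k /andP[k0 k1]; rewrite !mxE (negbTE k0) (negbTE k1) mulr0.
  rewrite !mxE eqxx (negbTE i10) eqxx /= d0 ltnn subnn !leq0n !add0n subn0 /=.
  case: ifP => _; last by rewrite !mul0r addr0 av0 // ltr01.
  by have := lt1 (d - j)%N; rewrite coefB !coefZ mulrN [_ * a2]mulrC [_ * a1]mulrC.
have hS i j : av (Syl^T i j) <= 1 by rewrite mxE; apply: Syl_integral.
have dS : av (\det Syl^T) = 1 by rewrite det_tr.
have vs := small_mulmx hav hS dS Sv.
have := vs i0; rewrite mxE eqxx => a2s.
by have := vs i1; rewrite mxE (negbTE i10) eqxx avN // => a1s; apply: h12.
Qed.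

Lemma inchart_unit_coef b a1 a2 : normalised a1 a2 ->
  exists i, 1 <= av (a2 *: inchart b F - a1 *: inchart b G)`_i.
Proof.
move=> n; have [i hi] := pencil_unit_coef n.
case: b => /=; first by exists i.
have [hid|hid] := leqP i d; last first.
  move: hi; rewrite nth_default ?av0 ?ler10 //.
  apply: leq_trans (size_polyD _ _) _; rewrite size_polyN geq_max.
  by rewrite !(leq_trans (size_scale_leq _ _)) // (leq_trans _ hid).
exists (d - i)%N; move: hi; rewrite !coefB !coefZ !coef_poly ltnS leq_subr subKn //.
Qed.

Lemma f_sim z w : sim z w -> sim (f z) (f w).
Proof.
move=> /andP[/eqP c h]; rewrite !f_inchart -c; set b := chart z.
have nz := inchart_normalised b (av_coord hav z).
have nw := inchart_normalised b (av_coord hav w).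
have [-> _] := proj_sim hav nz nw.
have iF := inchart_integral b hF; have iG := inchart_integral b hG.
rewrite wdqE // avM // -avM //; apply: av_mul_lt1 => //.
by apply: av_wdq; rewrite ?av_coord.
Qed.

Definition cdist z w := av (coord z - coord w).

Lemma cdist_f z w : sim z w -> cdist (f z) (f w) =
  cdist z w * av (wdq (inchart (chart z) F) (inchart (chart z) G) (coord z) (coord w)).
Proof.
move=> zw; have := f_sim zw; case/andP: (zw) => /eqP c h.
rewrite !f_inchart -c; set b := chart z.
have nz := inchart_normalised b (av_coord hav z).
have nw := inchart_normalised b (av_coord hav w).
have [_ e] := proj_sim hav nz nw; case/andP => /eqP c' _.
rewrite /cdist e; last by have [<- _] := proj_chart hav nz; have [<- _] := proj_chart hav nw.
by rewrite wdqE // avM.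
Qed.

(** Preimages of [a] in the chart of [z] are roots of [a2 F - a1 G]. This polynomial is small at the
    coordinate of [z] and has a coefficient of absolute value at least 1, so [near_root] applies. *)
Lemma f_lift a z : sim a (f z) -> exists w, sim w z /\ f w = a.
Proof.
rewrite f_inchart; set b := chart z; set x := coord z => s.
have n := hcoord_norm hav a; have nz := inchart_normalised b (av_coord hav z).
set a1 := (hcoord av a).1 in n; set a2 := (hcoord av a).2 in n.
have aE : proj a1 a2 = a by rewrite /a1 /a2 hcoordK.
move: s; rewrite -aE; have [-> _] := proj_sim hav n nz => s.
have [|x' rx' xx'] := @near_root _ _ _ hav _ x (inchart_unit_coef b n) (av_coord hav z).
  by rewrite hornerD hornerN !hornerZ avBC // [a2 * _]mulrC.
have hx' : if b then av x' <= 1 else av x' < 1.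
  have hx := av_coord hav z; rewrite (_ : x' = x - (x - x')); last by ring.
  case: ifP => cz; first by apply: avB_le => //; apply: ltW.
  by apply: avB_lt => //; apply: av_coord_lt => //; rewrite -/b cz.
have [cb cx] := chart_point hav hx'.
have hx1 : av x' <= 1 by case: (b) hx' => // /ltW.
exists (point b x'); split.
  by rewrite /sim cb cx eqxx /= avBC.
rewrite f_inchart cb cx; apply: (proj_eq hav (inchart_normalised b hx1) n).
move/rootP: rx'; rewrite hornerD hornerN !hornerZ => /eqP; rewrite subr_eq0 => /eqP.
by rewrite mulrC.
Qed.

Lemma fiber_bound z a : exists2 ws : seq (option E), (size ws <= d)%N &
  forall w, sim w z -> f w = a -> w \in ws.
Proof.
have n := hcoord_norm hav a.
set a1 := (hcoord av a).1 in n; set a2 := (hcoord av a).2 in n.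
have aE : proj a1 a2 = a by rewrite /a1 /a2 hcoordK.
set b := chart z; set h := a2 *: inchart b F - a1 *: inchart b G.
have [i hi] := inchart_unit_coef b n.
have h0 : h != 0 by apply: contraTneq hi; rewrite /h => ->; rewrite coef0 av0 // ler10.
have [rs hE] := closed_field_poly_normal h.
have lc : lead_coef h != 0 by rewrite lead_coef_eq0.
have sh : (size h <= d.+1)%N.
  apply: leq_trans (size_polyD _ _) _; rewrite size_polyN geq_max.
  by rewrite !(leq_trans (size_scale_leq _ _)) // size_inchart.
exists (map (point b) rs).
  by rewrite size_map -ltnS; apply: leq_trans sh; rewrite hE size_scale // size_prod_XsubC.
move=> w /andP[/eqP cw _] fw; rewrite -(chartK hav w) cw; apply: map_f.
have : root h (coord w); last by rewrite hE rootZ // root_prod_XsubC.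
apply/rootP; rewrite hornerD hornerN !hornerZ.
have nw := inchart_normalised b (av_coord hav w).
have [s e] := proj_sim hav nw n.
have e0 : proj (inchart b F).[coord w] (inchart b G).[coord w] = proj a1 a2.
  by rewrite aE -fw f_inchart cw.
apply/eqP; rewrite -(av_eq0 hav) [a2 * _]mulrC -e; first by rewrite e0 subrr av0.
by have [<- _] := proj_chart hav nw; have [<- _] := proj_chart hav n; rewrite e0.
Qed.

Definition critical z : Prop :=
  exists w w', [/\ sim w z, sim w' z, w <> w' & f w = f w'].

Lemma critical_sim z w : sim z w -> critical z -> critical w.
Proof.
by move=> zw [u [u' [uz uz' n e]]]; exists u, u'; split=> //; apply: sim_trans zw.
Qed.

(** Two distinct points of the class with the same image make the divided Wronskian vanish there,
    and modulo the maximal ideal it is constant on the class. *)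
Lemma critical_wdq z w w' : critical z -> sim w z -> sim w' z ->
  av (wdq (inchart (chart z) F) (inchart (chart z) G) (coord w) (coord w')) < 1.
Proof.
move=> [u [u' [uz uz' n e]]] wz wz'.
have uu' : sim u u' by apply: sim_trans uz _ => //; rewrite sim_sym.
have := cdist_f uu'; rewrite e /cdist subrr av0 // => /esym/eqP.
have /andP[/eqP cuu _] := uu'; have /andP[/eqP cu hu] := uz; have /andP[/eqP cu' hu'] := uz'.
have /andP[/eqP cw hw] := wz; have /andP[/eqP cw' hw'] := wz'.
rewrite mulf_eq0 av_eq0 // subr_eq0 => /orP[/eqP h|].
  by case: n; apply: (coord_inj hav cuu h).
rewrite cu av_eq0 // => /eqP W0.
rewrite -[wdq _ _ _ _]subr0 -W0; apply: eqm_wdq; rewrite ?av_coord //;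
  try by apply: inchart_integral.
- rewrite /eqm (_ : _ - _ = (coord w - coord z) - (coord u - coord z)); last by ring.
  exact: avB_lt.
- rewrite /eqm (_ : _ - _ = (coord w' - coord z) - (coord u' - coord z)); last by ring.
  exact: avB_lt.
Qed.

Lemma cdist_f_le z w : sim z w -> cdist (f z) (f w) <= cdist z w.
Proof.
move=> zw; rewrite cdist_f // ler_piMr ?av_ge0 //.
by apply: av_wdq; rewrite ?av_coord //; apply: inchart_integral.
Qed.

Lemma cdist_f_lt z w : critical z -> sim z w -> z <> w -> cdist (f z) (f w) < cdist z w.
Proof.
move=> cz zw n; have /andP[/eqP c _] := zw; rewrite cdist_f // gtr_pMr.
  by apply: critical_wdq => //; rewrite ?simxx // sim_sym.
rewrite av_gt0 // subr_eq0; apply/eqP => h; apply: n; exact: coord_inj c h.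
Qed.

Variable p : nat.
Hypotheses (hp : prime p) (hpadic : padic_on_nat av p) (dp : (d < p)%N).

(** The combination [h] vanishes at 0 and has a unit coefficient, the first one in some degree [e]
    with [0 < e <= d < p]. Its Wronskians with [G] and with [F] are the multiples of the Wronskian
    of [F] and [G] by the constant terms of [G] and [F], one of which is a unit. *)
Lemma wronskian_unit : exists i, 1 <= av (F^`() * G - F * G^`())`_i.
Proof.
have hx0 : av (0 : E) <= 1 by rewrite av0 // ler01.
have n := inchart_normalised true hx0; move: n; rewrite /= !horner_coef0 => n.
set h := G`_0 *: F - F`_0 *: G.
have [i0 hi0] : exists i, 1 <= av h`_i := pencil_unit_coef n.
have ih : integral_poly av h.
  by move=> i; rewrite coefB !coefZ; apply: avB_le => //; apply: av_mul_le1 => //; case: n.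
have [e /= he emin] : exists2 e, 1 <= av h`_e & forall i, (i < e)%N -> av h`_i < 1.
  have ex : exists i, 1 <= av h`_i by exists i0.
  case: (ex_minnP ex) => e he emin; exists e => // i ie.
  by rewrite ltNge; apply/negP => /emin; rewrite leqNgt ie.
have e1 : av h`_e = 1 by apply/eqP; rewrite eq_le ih.
have h0 : h`_0 = 0 by rewrite coefB !coefZ mulrC subrr.
have ep : (0 < e < p)%N.
  rewrite lt0n; apply/andP; split.
    by apply: contraTneq he => ->; rewrite h0 av0 // ler10.
  apply: leq_ltn_trans dp; rewrite leqNgt; apply: contraTN he => de.
  rewrite nth_default ?av0 ?ler10 //; apply: leq_trans de.
  apply: leq_trans (size_polyD _ _) _; rewrite size_polyN geq_max.
  by rewrite !(leq_trans (size_scale_leq _ _)).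
have W B : integral_poly av B -> av B`_0 = 1 -> av (h^`() * B - h * B^`())`_e.-1 = 1.
  by move=> iB B0; apply: (wronskian_unit_coef hav hp hpadic).
have fin c B : av c <= 1 -> integral_poly av B -> av B`_0 = 1 ->
    h^`() * B - h * B^`() = c *: (F^`() * G - F * G^`()) ->
    exists i, 1 <= av (F^`() * G - F * G^`())`_i.
  move=> hc iB B0 e2; exists e.-1; have := W B iB B0; rewrite e2 coefZ avM // => <-.
  by rewrite ler_piMl ?av_ge0.
case: (n) => F0 G0 nFG.
have [G1|G1] := eqVneq (av G`_0) 1.
  apply: (fin G`_0 G) => //.
  by rewrite /h derivB !derivZ -!mul_polyC; ring.
have [F1 _] := normalised_unit n G1.
apply: (fin F`_0 F) => //.
by rewrite /h derivB !derivZ -!mul_polyC; ring.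
Qed.

(** On a critical class in the unit disc the Wronskian is small, so one of its roots lies there;
    [None] represents the class of infinity. *)
Lemma critical_finite : exists cs : seq (option E),
  forall z, critical z -> exists2 c, c \in cs & sim c z.
Proof.
set W := F^`() * G - F * G^`(); have [i hi] := wronskian_unit.
have W0 : W != 0 by apply: contraTneq hi; rewrite -/W => ->; rewrite coef0 av0 // ler10.
have [rs WE] := closed_field_poly_normal W.
have lc : lead_coef W != 0 by rewrite lead_coef_eq0.
exists (None :: map Some rs) => z cz.
have [cz1|cz0] := boolP (chart z); last by exists None; [rewrite mem_head|apply: sim_infty].
have := critical_wdq cz (simxx hav z) (simxx hav z); rewrite cz1 wdq_diag /= -/W => Wz.
have [|r rr zr] := near_root hav _ (av_coord hav z) Wz; first by exists i.
have ar : av r <= 1.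
  rewrite (_ : r = coord z - (coord z - r)); last by ring.
  by apply: avB_le => //; [apply: av_coord|apply: ltW].
exists (Some r).
  by rewrite inE; apply/orP; right; apply: map_f; move: rr; rewrite WE rootZ // root_prod_XsubC.
by rewrite /sim cz1 /= ar eqxx /= avBC.
Qed.

End GoodReduction.
(** * Inertia on the tree of preimages *)

Section Inertia.
Variables (R : realFieldType) (E : closedFieldType) (av : E -> R) (p : nat).
Hypotheses (hav : nonarch_abs av) (hp : prime p) (hpadic : padic_on_nat av p).
Local Notation q := (p%:R : R).
Hypothesis htors : forall x, x != 0 -> exists2 k, (0 < k)%N & exists a : int, av x ^+ k = q ^ a.

(** Inertia preserves the value of a unit, and some positive power of [x] times a power of [p] is a
    unit. *)
Lemma inertia_isometry (K : E -> Prop) s x : in_inertia av K s -> av (s x) = av x.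
Proof.
move=> [[hs _] hi]; have [->|x0] := eqVneq x 0; first by rewrite aut0.
have [k k0 [a ka]] := htors x0.
pose y := x ^+ k * p%:R ^ a.
have q0 : (p%:R : R) != 0 := q_neq0 R hp.
have ay : av y = 1 by rewrite avM // avX // ka av_p_exp // -expfzDr // subrr.
have : av (s y) = 1.
  by rewrite -[RHS]ay; apply/esym/(av_close hav); rewrite avBC // ay; apply: hi; rewrite ay.
rewrite -ay /y (autM hs) (autX hs) (aut_exprz hs) (aut_nat hs) !avM // !avX //.
have pa : av (p%:R ^ a) != 0 by rewrite av_p_exp // gt_eqF // q_exp_gt0.
by move/(mulIf pa)/eqP; rewrite eqrXn2 ?av_ge0 // => /eqP.
Qed.

Lemma in_Gal_comp (K : E -> Prop) s t : in_Gal K s -> in_Gal K t -> in_Gal K (s \o t).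
Proof.
move=> [hs sK] [ht tK]; split; last by move=> x Kx /=; rewrite tK ?sK.
split=> [x y|x y||] /=; rewrite ?(autD ht) ?(autD hs) ?(autM ht) ?(autM hs) ?(aut1 ht) ?(aut1 hs) //.
by case: hs ht => _ _ _ bs [_ _ _ bt]; apply: bij_comp.
Qed.

Lemma in_Gal_id (K : E -> Prop) : in_Gal K id.
Proof. by split=> //; split=> //; exists id. Qed.

Lemma inertia_id (K : E -> Prop) : in_inertia av K id.
Proof. by split=> [|x _]; [exact: in_Gal_id|rewrite subrr av0 // ltr01]. Qed.

Lemma inertia_comp (K : E -> Prop) s t :
  in_inertia av K s -> in_inertia av K t -> in_inertia av K (s \o t).
Proof.
move=> hs ht; split; first by apply: in_Gal_comp; [case: hs|case: ht].
move=> x hx /=; have atx : av (t x) <= 1 by rewrite (inertia_isometry _ ht).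
rewrite (_ : _ - _ = (s (t x) - t x) + (t x - x)); last by ring.
by apply: avD_lt => //; [case: hs => _; apply|case: ht => _; apply].
Qed.

Lemma inertia_sub (K L : E -> Prop) s : (forall x, K x -> L x) ->
  in_inertia av L s -> in_inertia av K s.
Proof. by move=> KL [[hs sL] hi]; split=> //; split=> // x /KL; apply: sL. Qed.

Lemma act_comp (s t : E -> E) (z : option E) : act (s \o t) z = act s (act t z).
Proof. by case: z. Qed.

Lemma act_inj (s : E -> E) : field_aut s -> injective (act s).
Proof.
by move=> hs [x|] [y|] //= [/(aut_inj hs) ->].
Qed.

Lemma inertia_chart (K : E -> Prop) s z : in_inertia av K s ->
  chart av (act s z) = chart av z /\ coord av (act s z) = s (coord av z).
Proof.
move=> hs; have si := inertia_isometry _ hs; case: hs => -[hs _] _.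
case: z => [x|] /=; last by rewrite (aut0 hs).
by rewrite si; case: ifP => // _; rewrite (autV hs).
Qed.

Lemma inertia_sim (K : E -> Prop) s z : in_inertia av K s -> sim av (act s z) z.
Proof.
move=> hs; have [c e] := inertia_chart z hs.
by rewrite /sim c e eqxx /=; case: hs => _; apply; apply: av_coord.
Qed.

Lemma act_ratmap d (F G : {poly E}) (s : E -> E) z : field_aut s ->
  (forall i, s F`_i = F`_i) -> (forall i, s G`_i = G`_i) ->
  act s (ratmap d F G z) = ratmap d F G (act s z).
Proof.
move=> hs sF sG; case: z => [x|] /=.
  rewrite -!(aut_horner hs) // (aut_eq0 hs); case: ifP => //= _.
  by rewrite (aut_div hs) !(aut_horner hs).
by case: ifP => //= _; rewrite (aut_div hs) sF sG.
Qed.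

(** The product over the inertia orbit of [u] is fixed by inertia, so it has the value of an element
    of [K]. The orbit size is at most [size Y], hence divides its factorial. *)
Lemma inertia_orbit_value (K : E -> Prop) h (Y : seq E) u : is_subfield K ->
  (forall x, algebraic_over K x) -> torsion av p h K -> u != 0 ->
  (forall t, in_inertia av K t -> t u \in Y) ->
  exists a : int, av u ^+ ((size Y)`! * h)%N = q ^ a.
Proof.
move=> hK halg [h0 hh] u0 tY.
pose O := undup [seq y <- Y | `[< exists2 t, in_inertia av K t & y = t u >]].
have OP y : y \in O <-> exists2 t, in_inertia av K t & y = t u.
  rewrite mem_undup mem_filter; split=> [/andP[/asboolP]//|[t tK ->]].
  by rewrite tY // andbT; apply/asboolP; exists t.
have stable t : in_inertia av K t -> perm_eq (map t O) O.
  move=> tK; have ti : injective t by case: tK => -[/aut_inj].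
  have um : uniq (map t O) by rewrite map_inj_uniq // undup_uniq.
  apply: uniq_perm => //; first exact: undup_uniq.
  apply: (uniq_min_size um _ _).2; last by rewrite size_map.
  move=> _ /mapP[y /OP[s sK ->] ->]; apply/OP; exists (t \o s) => //.
  exact: inertia_comp.
have uO : u \in O by apply/OP; exists id => //; apply: inertia_id.
have sO : (0 < size O <= size Y)%N.
  apply/andP; split; first by case: (O) uO.
  by apply: leq_trans (size_undup _) _; rewrite size_filter count_size.
pose P := \prod_(y <- O) y.
have aP : av P = av u ^+ size O.
  rewrite av_prod // big_seq (eq_bigr (fun _ => av u)); last first.
    by move=> y /OP[t tK ->]; apply: (inertia_isometry _ tK).
  by rewrite -big_seq big_const_seq count_predT iter_mulr_1.
have P0 : P != 0 by rewrite -(av_eq0 hav) aP expf_neq0 // av_eq0.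
have [l Kl Pl] : exists2 l, K l & av P = av l.
  apply: (inertia_fixed_value hav hp hpadic htors hK halg P0) => s sK.
  case: (sK) => -[hs _] _; rewrite (aut_prod hs) -[RHS](perm_big _ (stable s sK)) /=.
  by rewrite big_map.
have [a ea] : exists a : int, av l ^+ h = q ^ a.
  by apply: hh => //; rewrite -(av_eq0 hav) -Pl av_eq0.
have /dvdnP[k ->] := dvdn_fact sO.
exists (a * k%:Z); rewrite (_ : (k * size O * h = size O * h * k)%N); last by ring.
by rewrite exprM exprM -aP Pl ea exprnP exprz_exp.
Qed.

End Inertia.

(** * Critical cycles, bounded orbits and tameness *)

Section Tree.
Variables (R : realFieldType) (E : closedFieldType) (av : E -> R) (p : nat).
Hypotheses (hav : nonarch_abs av) (hp : prime p) (hpadic : padic_on_nat av p).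
Variable K : E -> Prop.
Hypotheses (hK : is_subfield K) (halg : forall x, algebraic_over K x).
Variables (d : nat) (F G : {poly E}).
Hypotheses (d0 : (0 < d)%N) (dp : (d < p)%N) (hF : integral_poly av F) (hG : integral_poly av G).
Hypotheses (hFK : forall i, K F`_i) (hGK : forall i, K G`_i).
Hypotheses (hFsz : (size F <= d.+1)%N) (hGsz : (size G <= d.+1)%N).
Hypothesis hgood : av (hres d F G) = 1.
Variable h : nat.
Hypothesis hKtors : torsion av p h K.
Variables (a0 : E) (ha0 : K a0).

Local Notation q := (p%:R : R).
Local Notation f := (ratmap d F G).
Local Notation sim := (sim av).
Local Notation coord := (coord av).
Local Notation cdist := (cdist av).
Local Notation critical := (critical av d F G).

Let htors x : x != 0 -> exists2 k, (0 < k)%N & exists a : int, av x ^+ k = q ^ a.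
Proof. by move=> x0; apply: (torsion_alg hav hK hKtors (halg x) x0). Qed.

Lemma iter_f_sim n z w : sim z w -> sim (iter n f z) (iter n f w).
Proof. by move=> zw; elim: n => //= n; apply: f_sim. Qed.

Lemma iter_f_lift m a z : sim a (iter m f z) -> exists w, sim w z /\ iter m f w = a.
Proof.
elim: m z => [|m IH] z; first by exists a.
rewrite iterSr => /IH[w [wz wa]]; have [v [vz vw]] := f_lift hav d0 hF hG hFsz hGsz hgood wz.
by exists v; rewrite iterSr vw.
Qed.

Lemma iter_f_contract m z w : (0 < m)%N -> critical z -> sim z w -> z <> w ->
  cdist (iter m f z) (iter m f w) < cdist z w.
Proof.
case: m => // m _ cz zw nzw; rewrite !iterSr.
apply: le_lt_trans (cdist_f_lt hav d0 hF hG hFsz hGsz hgood cz zw nzw).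
have : sim (f z) (f w) by apply: f_sim.
move: (f z) (f w) => z' w' zw'; elim: m => //= m IH.
by apply: le_trans IH; apply: cdist_f_le => //; apply: iter_f_sim.
Qed.

Lemma act_iter s n z : in_Gal K s -> act s (iter n f z) = iter n f (act s z).
Proof.
move=> [hs sK]; elim: n => //= n IH.
by rewrite act_ratmap ?IH // => i; apply: sK.
Qed.

(* A second point of the residue class of [u], mapped to [u] by [f^m], gives a
   backward orbit along which the mutual distances strictly increase. *)
Lemma ramified_branch i m u v : (0 < m)%N -> iter i f u = Some a0 ->
  iter m f v = u -> sim v u -> v <> u -> critical u ->
  exists b, is_branch f (Some a0) b /\ infinitely_ramified av K (branch_tree K b).
Proof.
move=> m0 iu mv vu nvu cu.
(* A lift exists because [u] is the image of [v]. The implication inside the existential makes the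
   choice a total function [N]. *)
have next w : exists w', sim w u -> sim w' u /\ iter m f w' = w.
  have [wu|nwu] := boolP (sim w u); last by exists w.
  have [|w' [w'v w'w]] := @iter_f_lift m w v; first by rewrite mv.
  by exists w' => _; split=> //; apply: sim_trans vu.
pose N w := projT1 (cid (next w)).
have NP w : sim w u -> sim (N w) u /\ iter m f (N w) = w by apply: (projT2 (cid (next w))).
pose V k := if k is k'.+1 then iter k' N v else u.
have Vu k : sim (V k) u.
  case: k => [|k]; first exact: simxx.
  by elim: k => //= k IH; have [] := NP _ IH.
have Vm k : iter m f (V k.+1) = V k.
  case: k => // k; exact: (NP _ (Vu k.+1)).2.
have Vmn k n : iter (n * m) f (V (n + k)%N) = V k.
  by elim: n => // n IH; rewrite mulSn addnC iterD addSn Vm.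
have Vn k : V k.+1 <> V k.
  by elim: k => // k IH e; apply: IH; rewrite -[V k.+1]Vm e Vm.
(* [V n] lies at height [n * m + i] over [a0]; applying [f] as often as it is too high gives the
   point at height [n]. The branch passes through [V k] at height [k * m + i]. *)
pose b n := iter (n * m + i - n) f (V n).
have le n : (n <= n * m)%N by rewrite leq_pmulr.
have bB : is_branch f (Some a0) b.
  split; first by rewrite /b mul0n add0n subn0.
  move=> n; rewrite /b -iterS -[in RHS](Vm n) -iterD; congr (iter _ f _).
  by have := le n; have := m0; rewrite mulSn; lia.
have bV k : V k = b (k * m + i)%N.
  rewrite /b -{1}(Vmn k (k * m + i - k)%N) subnK; last first.
    by apply: leq_trans (le k) _; rewrite leq_addr.
  congr (iter _ f _); rewrite mulnBl; have := le k.
  rewrite mulnDl; have : (i <= i * m)%N by rewrite leq_pmulr.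
  have : (k * m <= k * m * m)%N by rewrite leq_pmulr.
  lia.
exists b; split=> // -[L [[hL KL finL] fixL]].
have [h' [h'0 hh']] := torsion_finite hav hK hL finL hKtors.
have halgL x : algebraic_over L x.
  by have [P [P0 [KP rP]]] := halg x; exists P; split=> //; split=> // j; apply: KL.
have fixV s k : in_inertia av L s -> act s (V k) = V k.
  move=> sL; apply: fixL => //; rewrite bV; exists id, (k * m + i)%N.
  by split; [exact: in_Gal_id|case: (b _)].
have step k : cdist (V k.+1) (V k) < cdist (V k.+2) (V k.+1).
  rewrite -{1}(Vm k.+1) -{1}(Vm k); apply: iter_f_contract => //.
    by apply: (critical_sim hav _ cu); rewrite sim_sym.
  by apply: sim_trans (Vu _) _ => //; rewrite sim_sym.
have val k : exists a : int, cdist (V k.+1) (V k) ^+ h' = q ^ a.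
  have s1 : sim (V k.+1) (V k) by apply: sim_trans (Vu _) _ => //; rewrite sim_sym.
  have nz : coord (V k.+1) - coord (V k) != 0.
    rewrite subr_eq0; apply/eqP => e; apply: (Vn k).
    by apply: (coord_inj hav _ e); case/andP: s1 => /eqP.
  have [s sL|l Ll e] := inertia_fixed_value hav hp hpadic htors hL halgL nz.
    have cV j : s (coord (V j)) = coord (V j).
      by have [_ <-] := inertia_chart hav hp hpadic htors (V j) sL; rewrite fixV.
    by case: sL => -[hs _] _; rewrite (autB hs) !cV.
  rewrite /cdist e; apply: hh' => //; by rewrite -(av_eq0 hav) -e av_eq0.
have [a ea] := val 0%N.
have grow k : exists2 a' : int, a + k%:Z <= a' & cdist (V k.+1) (V k) ^+ h' = q ^ a'.
  elim: k => [|k [a' la ea']]; first by exists a; rewrite ?addr0.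
  have [a'' ea''] := val k.+1; exists a'' => //.
  have : a' < a''.
    rewrite -(q_exp_lt R hp) -ea' -ea'' ltrXn2r ?step ?av_ge0 -?lt0n //.
  by move: la; clear; lia.
(* The exponents are integers increasing strictly from [a], so after [|a|] steps the distance is at
   least 1, although all [V k] lie in one residue class. *)
have [a' la ea'] := grow `|a|%N.
have lt1 : cdist (V `|a|.+1%N) (V `|a|%N) < 1.
  have : sim (V `|a|.+1%N) (V `|a|%N) by apply: sim_trans (Vu _) _ => //; rewrite sim_sym.
  by case/andP.
have : q ^ a' < q ^ 0 by rewrite -ea' expr0z exprn_ilt1 ?av_ge0 // -lt0n.
by rewrite q_exp_lt //; move: la; clear; lia.
Qed.

(** This relation contains the inertia orbit of [z] and speaks only of residue classes, so its size
    can be bounded level by level. *)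
Definition same_path n z w := [/\ iter n f z = Some a0, iter n f w = Some a0 &
  forall i, (i <= n)%N -> sim (iter i f z) (iter i f w)].

Lemma same_path_f n z w : same_path n.+1 z w -> same_path n (f z) (f w).
Proof.
move=> [hz hw zw]; split; rewrite -?iterSr // => i hi.
by rewrite -!iterSr; apply: zw.
Qed.

Lemma same_path_sim n z w : same_path n z w -> sim z w.
Proof. by case=> _ _ /(_ 0%N); apply. Qed.

Lemma inertia_same_path n z s : iter n f z = Some a0 -> in_inertia av K s ->
  same_path n z (act s z).
Proof.
move=> hz hs; case: (hs) => sG _; split=> // [|i _].
  by rewrite -act_iter // hz /=; case: sG => _ ->.
by rewrite -act_iter // sim_sym //; apply: (inertia_sim hav hp hpadic htors _ hs).
Qed.

Section NoRamifiedBranch.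
Hypothesis hno : forall b, is_branch f (Some a0) b ->
  ~ infinitely_ramified av K (branch_tree K b).

(** The points at which the bound on same-path points has to grow: a critical [z] without such a [w]
    is alone on its path. *)
Definition active n z := critical z /\ exists2 w, same_path n z w & w <> z.

(** If the class recurred, then by [ramified_branch] both [u] and its companion [w] would be fixed
    by the [m]-th iterate of [f], which brings them strictly closer. *)
Lemma periodic_not_active n m z : (0 < m)%N ->
  active n (iter m f z) -> ~ sim z (iter m f z).
Proof.
move=> m0 [cz [w wz nwz]] s; set u := iter m f z in cz wz nwz s.
have no i u' v : iter i f u' = Some a0 -> iter m f v = u' -> sim v u' -> critical u' -> v = u'.
  move=> h1 h2 h3 h4; have [//|nv] := pselect (v = u').
  by have [b [bb /(hno bb)]] := ramified_branch m0 h1 h2 h3 nv h4.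
case: (wz) => un wn path; have uw := same_path_sim wz.
have zu : z = u by apply: (no n).
have [|v [vz vw]] := @iter_f_lift m w z; first by rewrite -/u sim_sym.
have zw : sim z w by rewrite zu.
have vw' : v = w.
  apply: (no n) => //; first exact: sim_trans zw.
  exact: critical_sim uw cz.
have fu : iter m f u = u by rewrite -{1}zu.
have fw : iter m f w = w by rewrite -{1}vw'.
by have := iter_f_contract m0 cz uw (fun e => nwz (esym e)); rewrite fu fw ltxx.
Qed.

Variable cs : seq (option E).
Hypothesis hcs : forall z, critical z -> exists2 c, c \in cs & sim c z.

Let cls z := find (fun c => sim c z) cs.

Lemma cls_sim z w : critical z -> critical w -> cls z = cls w -> sim z w.
Proof.
have has_cls u : critical u -> has (fun c => sim c u) cs.
  by move=> /hcs[c cc cu]; apply/hasP; exists c.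
move=> /has_cls hz /has_cls hw e.
have := nth_find None hz; have := nth_find None hw; rewrite -/(cls z) -/(cls w) e => sw sz.
by apply: sim_trans sw => //; rewrite sim_sym.
Qed.

Fixpoint active_classes n z : seq nat :=
  if n is n'.+1 then
    if `[< active n z >] then cls z :: active_classes n' (f z) else active_classes n' (f z)
  else [::].

Lemma active_classesP n z c : c \in active_classes n z ->
  exists2 j, (j < n)%N & c = cls (iter j f z) /\ active (n - j) (iter j f z).
Proof.
elim: n z => //= n IH z.
have tail : c \in active_classes n (f z) ->
    exists2 j, (j < n.+1)%N & c = cls (iter j f z) /\ active (n.+1 - j) (iter j f z).
  by move=> /IH[j jn [-> aj]]; exists j.+1; rewrite // iterSr subSS.
case: asboolP => az; last exact: tail.
by rewrite inE => /orP[/eqP ->|/tail //]; exists 0%N.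
Qed.

Lemma active_classes_uniq n z : uniq (active_classes n z).
Proof.
elim: n z => //= n IH z; case: asboolP => az //=; rewrite IH andbT.
apply/negP => /active_classesP[j jn []]; rewrite -iterSr => e aj.
apply: (periodic_not_active _ aj) => //.
by apply: cls_sim e; [case: az|case: aj].
Qed.

Lemma active_classes_size n z : (size (active_classes n z) <= size cs)%N.
Proof.
rewrite -[X in (_ <= X)%N](size_iota 0); apply: uniq_leq_size; first exact: active_classes_uniq.
move=> c /active_classesP[j _ [-> [/hcs[c' c'cs sc'] _]]].
by rewrite mem_iota add0n /= -has_find; apply/hasP; exists c'.
Qed.

(** An active point multiplies the bound by [d]. Otherwise either [z] is critical and alone, or [f]
    is injective on its class and the bound for [f z] is inherited. *)
Lemma same_path_bound n z : exists2 ws : seq (option E),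
  (size ws <= d ^ size (active_classes n z))%N & forall w, same_path n z w -> w \in ws.
Proof.
elim: n z => [|n IH] z.
  by exists [:: Some a0] => // w [_ /= -> _]; rewrite mem_head.
have [ws sws hws] := IH (f z); rewrite /=.
case: asboolP => az.
  pose fib a := projT1 (cid2 (fiber_bound hav d0 hF hG hFsz hGsz hgood z a)).
  have fibP a : (size (fib a) <= d)%N /\ forall w, sim w z -> f w = a -> w \in fib a.
    by rewrite /fib; case: cid2.
  exists (flatten [seq fib a | a <- ws]).
    rewrite /= expnS; apply: (@leq_trans (d * size ws)); last by rewrite leq_mul2l sws orbT.
    elim: (ws) => //= a s IHs; rewrite size_cat mulnS leq_add //.
    by have [] := fibP a.
  move=> w zw; apply/flattenP; exists (fib (f w)).
    by apply: map_f; apply: hws; apply: same_path_f.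
  by apply: (fibP _).2 => //; rewrite sim_sym //; apply: same_path_sim zw.
have [cz|ncz] := pselect (critical z).
  exists [:: z]; first by rewrite /= expn_gt0 d0.
  move=> w zw; rewrite mem_seq1; have [-> //|nwz] := pselect (w = z).
  by case: az; split=> //; exists w.
have uni a : exists w0, forall w, sim w z -> f w = a -> w = w0.
  have [[w0 [w0z w0a]]|no] := pselect (exists w0, sim w0 z /\ f w0 = a).
    exists w0 => w wz wa; have [//|n0] := pselect (w = w0).
    by case: ncz; exists w, w0; rewrite wa.
  by exists z => w wz wa; case: no; exists w.
pose g a := projT1 (cid (uni a)).
have gP a w : sim w z -> f w = a -> w = g a by apply: (projT2 (cid (uni a))).
exists (map g ws); first by rewrite size_map.
move=> w zw; rewrite (gP (f w) w) //; first by apply: map_f; apply: hws; apply: same_path_f.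
by rewrite sim_sym //; apply: same_path_sim zw.
Qed.

End NoRamifiedBranch.

(** Reducing exponents modulo [n] by means of [x ^+ n] in [K], the powers below [n] span. *)
Lemma finite_adjoin_root n x : (0 < n)%N -> K (x ^+ n) -> finite_ext K (adjoin K x).
Proof.
move=> n0 Kx; split; first exact/adjoin_subfield/halg.
  by move=> y; apply: adjoin_base.
exists [seq x ^+ i | i <- iota 0 n] => _ [A [KA ->]].
rewrite size_map size_iota; case: (hK) => K0 K1 KB KM KV.
pose S y := exists c : nat -> E, (forall i, K (c i)) /\
  y = \sum_(i < n) c i * [seq x ^+ i | i <- iota 0 n]`_i.
have S0 : S 0.
  by exists (fun=> 0); split=> //; rewrite big1 // => i _; rewrite mul0r.
have SD y z : S y -> S z -> S (y + z).
  move=> [c [Kc ->]] [c' [Kc' ->]]; exists (fun i => c i + c' i); split; first by move=> i; apply: (subfieldD hK).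
  by rewrite -big_split; apply: eq_bigr => i _; rewrite mulrDl.
rewrite -/(S _) horner_coef; elim/big_ind: _ => // j _.
exists (fun i => if i == (j %% n)%N then A`_j * (x ^+ n) ^+ (j %/ n) else 0); split.
  by move=> i; case: ifP => // _; apply: (KM) => //; apply: (subfieldX hK).
have jn : (j %% n < n)%N by rewrite ltn_mod.
rewrite (bigD1 (Ordinal jn)) //= eqxx big1 ?addr0; last first.
  by move=> i; rewrite -val_eqE /= => /negbTE ->; rewrite mul0r.
rewrite (nth_map 0%N) ?size_iota // nth_iota // add0n -mulrA -exprM -exprD.
by rewrite mulnC -divn_eq.
Qed.

(* Tameness: the orbit of a point under [s] has length at most [d < p], so the
   increments [s^j u] cannot all be congruent to [u] and add up to zero. *)
Lemma tame_fixed s z (u := coord (act s z) - coord z) : in_inertia av K s ->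
  act s (f z) = f z -> (u != 0 -> av (s u - u) < av u) -> act s z = z.
Proof.
move=> hs fz hu; case: (hs) => -[sa sK] _.
have ch j : chart av (iter j (act s) z) = chart av z /\
    coord (iter j (act s) z) = iter j s (coord z).
  elim: j => //= j [c1 c2]; have [-> ->] := inertia_chart hav hp hpadic htors (iter j (act s) z) hs.
  by rewrite c1 c2.
have [us|us] := eqVneq u 0.
  by apply: (coord_inj hav (ch 1%N).1); apply/eqP; rewrite -subr_eq0 -/u us.
have {}hu := hu us; exfalso.
have fj j : f (iter j (act s) z) = f z.
  by elim: j => //= j IH; rewrite -[RHS]fz -IH act_ratmap // => i; apply: sK.
have sj j : sim (iter j (act s) z) z.
  elim: j => [|j IH]; first exact: simxx.
  by apply: sim_trans IH => //; apply: (inertia_sim hav hp hpadic htors _ hs).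
have [ws sws hws] := fiber_bound hav d0 hF hG hFsz hGsz hgood z (f z).
(* The [d.+1] first iterates lie in a fibre with at most [d] points of the class, so two coincide,
   and [s] is injective. *)
have [m /andP[m0 md] pm] : exists2 m, (0 < m <= d)%N & iter m (act s) z = z.
  have : ~~ uniq [seq iter j (act s) z | j <- iota 0 d.+1].
    apply/negP => un; have : (size [seq iter j (act s) z | j <- iota 0 d.+1] <= size ws)%N.
      by apply: uniq_leq_size => // _ /mapP[j _ ->]; apply: hws.
    by rewrite size_map size_iota leqNgt ltnS sws.
  case/(uniqPn None) => i [j [ij]]; rewrite size_map size_iota => jd.
  rewrite !(nth_map 0%N) ?size_iota ?(ltn_trans ij) // !nth_iota ?(ltn_trans ij) // !add0n => e.
  exists (j - i)%N; first by rewrite subn_gt0 ij /=; move: jd; rewrite ltnS; apply: leq_trans; rewrite leq_subr.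
  have iinj : injective (iter i (act s)).
    by elim: (i) => //= k IH x y /(act_inj sa)/IH.
  by apply: iinj; rewrite -iterD subnKC ?(ltnW ij).
have uE : u = s (coord z) - coord z by rewrite /u (ch 1%N).2.
clearbody u.
have sit j x : av (iter j s x) = av x.
  by elim: j => //= j IH; rewrite (inertia_isometry hav hp hpadic htors _ hs).
have sB j x y : iter j s (x - y) = iter j s x - iter j s y.
  by elim: j => //= j ->; rewrite (autB sa).
have near j : av (iter j s u - u) < av u.
  elim: j => [|j IH]; first by rewrite subrr av0 // av_gt0.
  rewrite (_ : _ - _ = iter j s (s u - u) + (iter j s u - u)); last first.
    by rewrite sB -iterSr /=; ring.
  by apply: avD_lt => //; rewrite sit.
have tele : \sum_(j < m) iter j s u = 0.
  rewrite -(big_mkord xpredT (fun j => iter j s u)).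
  rewrite (eq_bigr (fun j => iter j.+1 s (coord z) - iter j s (coord z))); last first.
    by move=> j _; rewrite uE sB iterSr.
  by rewrite (telescope_sumr (fun j => iter j s (coord z))) //= -(ch m).2 pm subrr.
(* As the increments add up to zero, [m u] is a sum of differences smaller than [u]; but
   [m <= d < p] is a unit. *)
have : av (u *+ m) < av u.
  rewrite (_ : u *+ m = - \sum_(j < m) (iter j s u - u)).
    by rewrite avN //; apply: av_sum_lt => //; rewrite av_gt0.
  by rewrite sumrB tele sub0r opprK sumr_const card_ord.
rewrite -mulr_natr avM // (av_small_nat hp hpadic) ?mulr1 ?ltxx //.
by rewrite m0 (leq_ltn_trans md).
Qed.

Lemma tree_finitely_ramified :
  (forall b, is_branch f (Some a0) b -> ~ infinitely_ramified av K (branch_tree K b)) ->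
  ~ infinitely_ramified av K (preimage_tree f (Some a0)).
Proof.
move=> hno; apply; case: (hKtors) => h0 _.
have [cs hcs] := critical_finite hav d0 hF hG hFsz hGsz hgood hp hpadic dp.
(* [B] bounds the same-path points at every height, so there are at most [B * B] differences of
   their coordinates; [N] is the resulting common exponent for the values of all increments. *)
pose B := (d ^ size cs)%N; pose N := ((B * B)`! * h)%N.
have N0 : (0 < N)%N by rewrite muln_gt0 fact_gt0.
have [w ww] : exists w : E, w ^+ N = p%:R.
  have [w rw] : exists w, root ('X^N - (p%:R : E)%:P) w.
    by apply: closed_rootP; rewrite size_XnsubC // neq_ltn ltnS N0 orbT.
  exists w; move/rootP: rw; rewrite hornerD hornerN hornerXn hornerC => /eqP.
  by rewrite subr_eq0 => /eqP.
have Kp : K (w ^+ N) by rewrite ww; apply: (subfield_nat hK).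
exists (adjoin K w); split; first exact: (finite_adjoin_root N0 Kp).
move=> s sL.
have sK : in_inertia av K s.
  by apply: inertia_sub sL => x; apply: adjoin_base.
have sw : s w = w by case: sL => -[_ + _]; apply; apply: adjoin_gen.
move=> z [n]; elim: n z => [|n IH] z hz; first by move: hz => /= ->; rewrite /=; case: sK => -[_ ->].
apply: (tame_fixed sK); first by apply: IH; move: hz; rewrite iterSr.
set u := _ - _ => u0.
have [ws sws hws] := same_path_bound cs n.+1 z.
have wsB : (size ws <= B)%N.
  apply: leq_trans sws _; rewrite leq_pexp2l //.
  exact: (active_classes_size hno hcs).
pose Y := [seq coord x - coord y | x <- ws, y <- ws].
have tY t : in_inertia av K t -> t u \in Y.
  move=> tK; case: (tK) => -[ta _] _; rewrite /u (autB ta).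
  have [_ <-] := inertia_chart hav hp hpadic htors (act s z) tK.
  have [_ <-] := inertia_chart hav hp hpadic htors z tK.
  rewrite -act_comp; apply: allpairs_f; apply: hws; apply: inertia_same_path => //.
  exact: (inertia_comp hav hp hpadic htors).
have [a ea] := inertia_orbit_value hav hp hpadic htors hK halg hKtors u0 tY.
have [a' ea'] : exists a' : int, av u ^+ N = q ^ a'.
  have : (size Y <= B * B)%N by rewrite size_allpairs leq_mul.
  move/bin_fact; set c := binomial _ _; set e := factorial (_ - _)%N => kE.
  exists (a * (c * e)%:Z); rewrite /N -kE.
  rewrite (_ : (c * ((size Y)`! * e) * h = (size Y)`! * h * (c * e))%N); last by ring.
  by rewrite exprM ea exprnP exprz_exp.
have q0 : q != 0 := q_neq0 R hp.
have aw0 : 0 < av w.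
  have : w ^+ N != 0 by rewrite ww -(av_eq0 hav) (av_p hp hpadic) invr_eq0.
  by rewrite av_gt0 // expf_eq0 N0.
(* The power of [w], an [N]-th root of [p], makes [y] a unit. Since [s] fixes [w], the congruence of
   [s y] and [y] says that [s u - u] is smaller than [u]. *)
pose y := u * w ^ a'.
have aw : av (w ^ a') ^+ N = q ^ (- a').
  rewrite -avX // exprnP exprz_exp mulrC -exprz_exp -exprnP ww; exact: av_p_exp.
have ay : av y = 1.
  apply/eqP; rewrite -(@eqrXn2 _ N) ?av_ge0 ?ler01 //.
  by rewrite avM // exprMn ea' aw -expfzDr // subrr expr1n.
have : av (s y - y) < 1 by case: sK => _; apply; rewrite ay.
case: sK => -[sa _] _; rewrite /y (autM sa) (aut_exprz sa) sw -mulrBl.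
by rewrite -[X in _ < X]ay /y !avM // ltr_pM2r // av_gt0 // expfz_neq0 // -(av_eq0 hav) gt_eqF.
Qed.

End Tree.

(** * From finitely ramified branches to a finitely ramified tree *)

Theorem theorem4p5
  (p : nat) (hp : prime p)
  (R : realFieldType) (Kbar : closedFieldType)
  (hchar0 : forall n : nat, (n.+1)%:R != 0 :> Kbar)
  (av : Kbar -> R) (hav : nonarch_abs av) (hpadic : padic_on_nat av p)
  (hQp : complete_in av (Qp_in av))
  (K : Kbar -> Prop) (hK : is_subfield K)
  (hQpK : forall x, Qp_in av x -> K x) (hfin : finite_over (Qp_in av) K)
  (halg : forall x : Kbar, algebraic_over K x)
  (d : nat) (hd : (2 <= d < p)%N)
  (F G : {poly Kbar})
  (hFint : forall i, K F`_i /\ av F`_i <= 1)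
  (hGint : forall i, K G`_i /\ av G`_i <= 1)
  (hFsz : (size F <= d.+1)%N) (hGsz : (size G <= d.+1)%N)
  (hgood : av (hres d F G) = 1)
  (a0 : Kbar) (ha0 : K a0) :
  infinitely_ramified av K (preimage_tree (ratmap d F G) (Some a0)) ->
  exists b : nat -> option Kbar,
    is_branch (ratmap d F G) (Some a0) b /\
    infinitely_ramified av K (branch_tree K b).
Proof.
move=> ramT; case/andP: hd => d2 dp; have d0 : (0 < d)%N := ltnW d2.
have [h hK'] := torsion_over_Qp hav hp hpadic hK hfin.
have hF : integral_poly av F by move=> i; case: (hFint i).
have hG : integral_poly av G by move=> i; case: (hGint i).
have hFK i : K F`_i by case: (hFint i).
have hGK i : K G`_i by case: (hGint i).
have [//|no] := pselect (exists b : nat -> option Kbar,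
    is_branch (ratmap d F G) (Some a0) b /\ infinitely_ramified av K (branch_tree K b)).
exfalso; apply: (tree_finitely_ramified hav hp hpadic hK halg d0 dp hF hG hFK hGK
  hFsz hGsz hgood hK' ha0 _ ramT) => b hb ramb.
by apply: no; exists b.
Qed.
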